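(* Consider the networked feedback system described in the context, satisfying Assumptions A1, A2 and A3, with the receiver weights $\alpha_0,\dots,\alpha_{\bar\tau}$ fixed, and let $K\in\mathcal{K}$ be a controller. Then the networked feedback system is mean-square input-output stable if and only if $$\|W(z)T(z)\|_2^2<1,$$ where $W=\Phi/H$ is the frequency response of variation of the channel and $T=HKP(1-HKP)^{-1}$.
   Context: Setting. Fix an integer $\bar\tau\ge 1$ and let $\mathcal{D}=\{0,1,\dots,\bar\tau\}$. The plant $P(z)$ is a SISO discrete-time LTI system with strictly proper real-rational transfer function. The controller $K(z)$ is a SISO discrete-time LTI system with proper real-rational transfer function. Time is $k=0,1,2,\dots$. The system is at rest at $k=0$, so all signals are zero for negative times. The external input is $v(k)$. The plant output is $y=P(v+u_d)$, where the plant input is $v(k)+u_d(k)$, and the controller output is $u=Ky$. Channel and receiver. The control signal $u(k)$ is sent over a channel with random delay $\tau_k\in\mathcal{D}$. The receiver uses fixed real weights $\alpha_0,\dots,\alpha_{\bar\tau}$ and outputs $$u_d(k)=\sum_{i=0}^{\bar\tau}\alpha_i\,\delta(\tau_{k-i}-i)\,u(k-i),$$ where $\delta$ is the Kronecker delta: $\delta(0)=1$ and $\delta(m)=0$ for $m\neq 0$. Assumptions. - A1: $\{\tau_k\}$ is i.i.d. with $\Pr\{\tau_k=i\}=p_i$ for $i\in\mathcal{D}$, where $p_i\in[0,1]$ and $\sum_i p_i=1$. - A2: the input sequence $\{v(k)\}$ is independent of $\{\tau_k\}$. - A3: $P$ is stabilizable and detectable, and there is no unstable pole-zero cancellation between $H$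 and $P$, where $H(z)=\sum_{i=0}^{\bar\tau}\alpha_ip_iz^{-i}$ is the mean channel. Nominal system and controllers. The nominal system is $G=KP(1-HKP)^{-1}$, and $\mathcal{K}$ is the set of proper controllers $K$ internally stabilizing $G$. Channel uncertainty and frequency response of variation. For fixed $n$, define $\omega(k,n)=\alpha_i[\delta(\tau_n-i)-p_i]$ if $k=n+i$ with $i\in\mathcal{D}$, and $\omega(k,n)=0$ otherwise. Define $r(l)=\mathbb{E}\{\sum_{k}\omega(k,n)\omega(k+l,n)\}$, which does not depend on $n$. Explicitly: - $r(0)=\sum_{i=0}^{\bar\tau}\alpha_i^2p_i(1-p_i)$; - $r(l)=r(-l)=-\sum_{i=0}^{\bar\tau-l}\alpha_i\alpha_{i+l}p_ip_{i+l}$ for $1\le l\le\bar\tau$; - $r(l)=0$ for $|l|>\bar\tau$. The energy spectral density is $S_\Omega(z)=\sum_l r(l)z^{-l}$. Let $\Phi(z)$ be a minimum-phase polynomial in $z^{-1}$ of degree $\bar\tau$ with real coefficients such that $S_\Omega(z)=\Phi(z^{-1})\Phi(z)$ (spectral factor). The frequency response of variation is $W=\Phi/H$, and the complementary sensitivity is $T=HKP(1-HKP)^{-1}$. Norms: $\|F\|_2^2=\frac{1}{2\pi}\int_{-\pi}^{\pi}|F(e^{j\theta})|^2d\theta$. Definition. The system is mean-square input-output stable if $K$ internally stabilizes $G$ and, for every i.i.d. input process $\{v(k)\}$ with bounded variance that is independent of $\{\tau_k\}$, the variances of $u(k)$ are bounded over $k$. *)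

(* Defs.v *)
From HB Require Import structures.
From mathcomp Require Import all_boot all_order all_algebra.
From mathcomp Require Import all_classical all_reals all_analysis.
From mathcomp Require Import complex.

Set Implicit Arguments.
Unset Strict Implicit.
Unset Printing Implicit Defensive.

Import Order.TTheory GRing.Theory Num.Theory.
Local Open Scope classical_set_scope.
Local Open Scope ring_scope.

Section Defs.
Variable R : realType.

Definition sqmod (x : R[i]) : R := let: Complex a b := x in a ^+ 2 + b ^+ 2.

Definition cpoly (a : {poly R}) : {poly R[i]} := map_poly (real_complex R) a.

(* ---------- transfer functions ----------
   All SISO real-rational transfer functions are written as
   F(z) = b(z^-1) / a(z^-1) with b a : {poly R} polynomials in q = z^-1.
   A rational function n/d (in q) is stable iff, after cancelling common
   factors, its denominator has no root q with |q| <= 1, i.e. no pole z with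
   |z| >= 1 (q = 0 <-> z = oo, so this also encodes properness). *)
Definition stable_rat (n d : {poly R}) : Prop :=
  d != 0 /\
  forall q : R[i], sqmod q <= 1 -> ~~ root (cpoly (d %/ gcdp n d)) q.

(* the mean channel H(z) = sum_i alpha_i p_i z^-i, as a polynomial in q *)
Definition Hpoly (tb : nat) (alpha p : nat -> R) : {poly R} :=
  \sum_(i < tb.+1) (alpha i * p i) *: 'X^i.

(* characteristic polynomial (times aK aP) of 1 - H K P *)
Definition char_loop (tb : nat) (alpha p : nat -> R) (bP aP bK aK : {poly R}) :=
  aK * aP - Hpoly tb alpha p * bK * bP.

(* K internally stabilizes G = KP(1-HKP)^-1: the loop P -> K -> H -> P is
   well posed and all nine closed-loop transfer functions from signals
   injected at the inputs of P, K, H to the inputs of P, K, H are stable.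
   They are 1/(1-L), P/(1-L), K/(1-L), H/(1-L), KP/(1-L), HK/(1-L),
   PH/(1-L) with L = HKP (1/(1-L) occurs three times). *)
Definition internally_stable (tb : nat) (alpha p : nat -> R)
    (bP aP bK aK : {poly R}) : Prop :=
  let h := Hpoly tb alpha p in
  let chi := char_loop tb alpha p bP aP bK aK in
  [/\ stable_rat (aK * aP) chi,
      stable_rat (bP * aK) chi,
      stable_rat (bK * aP) chi,
      stable_rat (h * aK * aP) chi &
      [/\ stable_rat (bK * bP) chi,
           stable_rat (h * bK * aP) chi &
           stable_rat (h * bP * aK) chi]].

(* A3 (part): no unstable pole-zero cancellation between H and P.  H has
   its only poles at z = 0; an unstable zero of H (|z| >= 1, i.e. |q| <= 1)
   must not be an (unstable) pole of P = bP/aP (bP, aP coprime). *)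
Definition no_unstable_cancel (tb : nat) (alpha p : nat -> R)
    (aP : {poly R}) : Prop :=
  forall q : R[i], sqmod q <= 1 ->
    root (cpoly (Hpoly tb alpha p)) q -> ~~ root (cpoly aP) q.

Definition sh (s : nat -> R) (k i : nat) : R :=
  if (i <= k)%N then s (k - i)%N else 0.

(* y = (b(q)/a(q)) x with zero initial conditions:
   sum_i a_i y(k-i) = sum_i b_i x(k-i) *)
Definition lti_eq (b a : {poly R}) (x y : nat -> R) : Prop :=
  forall k, \sum_(i < size a) a`_i * sh y k i = \sum_(i < size b) b`_i * sh x k i.

Definition loop_eqs (tb : nat) (alpha : nat -> R) (bP aP bK aK : {poly R})
    (v : nat -> R) (tau : nat -> 'I_tb.+1) (y u ud : nat -> R) : Prop :=
  [/\ lti_eq bP aP (fun k => v k + ud k) y,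
      lti_eq bK aK y u &
      forall k, ud k = \sum_(i < tb.+1)
        (if (i <= k)%N then alpha i * (tau (k - i)%N == i :> nat)%:R * u (k - i)%N
         else 0)].

Local Open Scope ereal_scope.

Definition tau_iid (tb : nat) d (T : measurableType d) (P : probability T R)
    (tau : nat -> T -> 'I_tb.+1) (p : nat -> R) : Prop :=
  (forall k (i : 'I_tb.+1), measurable (tau k @^-1` [set i])) /\
  forall n (c : 'I_n -> 'I_tb.+1),
    P [set w | forall j : 'I_n, tau j w = c j] = (\prod_(j < n) p (c j))%:E.

Definition v_iid d (T : measurableType d) (P : probability T R)
    (v : nat -> T -> R) : Prop :=
  (forall k, measurable_fun setT (v k)) /\
  forall n (B : 'I_n -> set R), (forall j, measurable (B j)) ->
    P [set w | forall j : 'I_n, B j (v j w)]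
    = (\prod_(j < n) fine (P (v 0%N @^-1` B j)))%:E.

Definition finite_variance d (T : measurableType d) (P : probability T R)
    (v : nat -> T -> R) : Prop :=
  'E_P[fun w => (v 0%N w ^+ 2)%R] < +oo.

Definition indep_v_tau (tb : nat) d (T : measurableType d) (P : probability T R)
    (v : nat -> T -> R) (tau : nat -> T -> 'I_tb.+1) : Prop :=
  forall n (B : 'I_n -> set R) (c : 'I_n -> 'I_tb.+1),
    (forall j, measurable (B j)) ->
    P ([set w | forall j : 'I_n, B j (v j w)] `&`
       [set w | forall j : 'I_n, tau j w = c j])
    = P [set w | forall j : 'I_n, B j (v j w)] *
      P [set w | forall j : 'I_n, tau j w = c j].

Definition ms_io_stable (tb : nat) (alpha p : nat -> R)
    (bP aP bK aK : {poly R}) : Prop :=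
  internally_stable tb alpha p bP aP bK aK /\
  forall d (T : measurableType d) (P : probability T R)
    (tau : nat -> T -> 'I_tb.+1) (v : nat -> T -> R),
    tau_iid P tau p -> v_iid P v -> finite_variance P v ->
    indep_v_tau P v tau ->
    forall y u ud : nat -> T -> R,
      (forall w, loop_eqs alpha bP aP bK aK (fun k => v k w) (fun k => tau k w)
                   (fun k => y k w) (fun k => u k w) (fun k => ud k w)) ->
      exists M : R, forall k, 'V_P[u k] <= M%:E.

Local Close Scope ereal_scope.

(* r(l), 0 <= l <= tb (r(-l) = r(l), r(l) = 0 for |l| > tb) *)
Definition rcorr (tb : nat) (alpha p : nat -> R) (l : nat) : R :=
  if l == 0%N then \sum_(i < tb.+1) alpha i ^+ 2 * p i * (1 - p i)
  else - \sum_(i < (tb - l).+1) alpha i * alpha (i + l)%N * p i * p (i + l)%N.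

(* S_Omega(z) = sum_l r(l) z^-l *)
Definition S_Omega (tb : nat) (alpha p : nat -> R) (z : R[i]) : R[i] :=
  \sum_(l < tb.+1)
     if l == 0%N :> nat then real_complex R (rcorr tb alpha p 0)
     else real_complex R (rcorr tb alpha p l) * (z ^- l + z ^+ l).

(* Phi(z) = phi(z^-1) with phi : {poly R} of degree (at most) tb is a
   minimum-phase spectral factor: S_Omega(z) = Phi(z^-1) Phi(z) for all
   z != 0, and all zeros of Phi lie in the closed unit disc. *)
Definition spectral_factor (tb : nat) (alpha p : nat -> R) (phi : {poly R}) : Prop :=
  [/\ (size phi <= tb.+1)%N,
      (forall z : R[i], z != 0 ->
         S_Omega tb alpha p z = (cpoly phi).[z] * (cpoly phi).[z^-1]) &
      (forall z : R[i], z != 0 -> root (cpoly phi) z^-1 -> sqmod z <= 1)].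

Definition WT_resp (tb : nat) (alpha p : nat -> R) (bP aP bK aK phi : {poly R})
    (theta : R) : R[i] :=
  let z : R[i] := Complex (cos theta) (sin theta) in
  let q := z^-1 in
  let Hz := (cpoly (Hpoly tb alpha p)).[q] in
  let Pz := (cpoly bP).[q] / (cpoly aP).[q] in
  let Kz := (cpoly bK).[q] / (cpoly aK).[q] in
  let Wz := (cpoly phi).[q] / Hz in
  let Tz := Hz * Kz * Pz / (1 - Hz * Kz * Pz) in
  Wz * Tz.

Definition H2_sq (tb : nat) (alpha p : nat -> R) (bP aP bK aK phi : {poly R})
    : \bar R :=
  (((2 * pi)^-1)%:E *
   \int[@lebesgue_measure R]_(t in `[(- pi)%R, pi])
      (sqmod (WT_resp tb alpha p bP aP bK aK phi t))%:E)%E.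

End Defs.

(* Main.v *)
Require Import Defs.
From HB Require Import structures.
From mathcomp Require Import all_boot all_order all_algebra.
From mathcomp Require Import all_classical all_reals all_analysis.
From mathcomp Require Import complex.
From mathcomp Require Import measurable_realfun ring lra zify.
Import Order.TTheory GRing.Theory Num.Theory.
Import numFieldNormedType.Exports.
Local Open Scope ring_scope.

Set Implicit Arguments.
Unset Strict Implicit.
Unset Printing Implicit Defensive.

(* In the variable q = z^-1 every signal is a formal power series.  With
   g = KP/(1-HKP) the loop reads u = g * (v + e), where e is the output of the
   zero-mean channel uncertainty driven by u.  As P is strictly proper, u(n)
   depends on v and on the delays before n only, so the contributions of the
   different delays to u(k) are uncorrelated and the second moments U satisfy
   the renewal equation U(k) = X(k) + sum_(m < k) f(k - m) U(m); here X is the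
   second moment of g * v, and f(j) is the variance of the j-th coefficient of
   omega * g.  By Parseval and the spectral factorization, the sum F of the f(j)
   is the squared norm of WT.  If F < 1 then U <= sup X / (1 - F).  If F >= 1,
   Rademacher inputs make X nondecreasing and eventually positive, and then
   U cannot be bounded. *)

Local Open Scope classical_set_scope.
Local Notation normc := ComplexField.Normc.normc.

(** * Convolution of sequences and stable denominators *)

(** The response [g] comes from the fraction of [bK * bP] by [chi] after division by the gcd:
    internal stability frees the reduced denominator [d] of zeros in the closed disc, so [g] is
    absolutely summable. This yields both Parseval's identity, through uniform polynomial
    approximation on the circle, and the bound on X. The integrand [WT_resp] is computed from the
    unreduced data and may divide by zero, so it is compared with the reduced one outside finitely
    many angles. Independence is given on finite cylinders only. Hence [u k] is written as a finite
    combination of inputs whose coefficients are functions of the word of the first [k] delays, and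
    expectations are split along such words. For sufficiency the inputs may have a nonzero mean, but
    the variance is at most the second moment. For necessity centred inputs make the two equal, and
    a probability space carrying inputs and delays has to be built: the unit interval, coded by
    expanding maps. At F = 1 no geometric growth of U can be expected, which is why divergence is
    derived from monotonicity and a supremum. *)

Definition convol {K : nzRingType} (f g : nat -> K) (k : nat) : K :=
  \sum_(i < k.+1) f i * g (k - i)%N.

Definition coefs {K : nzRingType} (a : {poly K}) (k : nat) : K := a`_k.

(** A coefficient below [N] sees only truncations at [N], so the algebraic laws of convolution are
    inherited from polynomials. *)
Lemma convol_trunc {K : nzRingType} (f g : nat -> K) (N k : nat) : (k < N)%N ->
  convol f g k = ((\poly_(i < N) f i) * (\poly_(i < N) g i))`_k.
Proof.
move=> kN; rewrite coefM; apply: eq_bigr => -[i /= ik] _.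
rewrite !coef_poly (leq_trans ik kN).
by rewrite (leq_ltn_trans (leq_subr _ _) kN).
Qed.

Lemma convol_coefs {K : nzRingType} (a b : {poly K}) :
  convol (coefs a) (coefs b) = coefs (a * b).
Proof. by apply/funext => k; rewrite /convol /coefs coefM. Qed.

Lemma convolC {K : comNzRingType} (f g : nat -> K) : convol f g = convol g f.
Proof. by apply/funext => k; rewrite !(@convol_trunc _ _ _ k.+1) // mulrC. Qed.

Lemma convolA {K : comNzRingType} (f g h : nat -> K) :
  convol f (convol g h) = convol (convol f g) h.
Proof.
have aux (u v w : nat -> K) k : convol u (convol v w) k =
    (\poly_(i < k.+1) u i * (\poly_(i < k.+1) v i * \poly_(i < k.+1) w i))`_k.
  rewrite coefM; apply: eq_bigr => -[i /= ik] _.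
  rewrite (@convol_trunc _ v w k.+1) ?ltnS ?leq_subr //.
  by rewrite coef_poly ik.
apply/funext => k; rewrite aux [RHS](congr1 (@^~ k) (convolC _ _)) aux mulrA mulrC.
by congr (_`_k); rewrite mulrC mulrA mulrC mulrA -mulrA [X in _ * X]mulrC mulrA mulrC.
Qed.

Lemma convol1 {K : nzRingType} (f : nat -> K) : convol (coefs 1) f = f.
Proof.
apply/funext => k; rewrite /convol big_ord_recl /coefs coef1 /= mul1r subn0.
by rewrite big1 ?addr0 // => i _; rewrite coef1 /= mul0r.
Qed.

Lemma convolDr {K : nzRingType} (f g h : nat -> K) :
  convol f (fun k => g k + h k) = (fun k => convol f g k + convol f h k).
Proof.
by apply/funext => k; rewrite /convol -big_split; apply: eq_bigr => i _; rewrite mulrDr.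
Qed.

Lemma convolBr {K : nzRingType} (f g h : nat -> K) :
  convol f (fun k => g k - h k) = (fun k => convol f g k - convol f h k).
Proof.
by apply/funext => k; rewrite /convol -sumrB; apply: eq_bigr => i _; rewrite mulrBr.
Qed.

Lemma convol_inj {K : fieldType} (a x y : nat -> K) :
  a 0%N != 0 -> convol a x = convol a y -> x = y.
Proof.
move=> a0 axy; apply/funext => k.
elim/ltn_ind: k => k IH.
have := congr1 (@^~ k) axy; rewrite /convol /= !big_ord_recl /= !subn0.
rewrite (eq_bigr (fun i : 'I_k => a (lift ord0 i) * y (k - lift ord0 i)%N)).
  by move=> /addIr/(mulfI a0).
by move=> i _; rewrite IH // ltn_subrL /= (leq_ltn_trans _ (ltn_ord i)).
Qed.

(** Course-of-values recursion for a functional on whole sequences: [tab n] lists the first [n]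
    values, and the causality hypothesis makes the default value beyond its end harmless. *)
Lemma strong_rec {X : Type} (x0 : X) (F : nat -> (nat -> X) -> X) :
  (forall k x y, (forall j, (j < k)%N -> x j = y j) -> F k x = F k y) ->
  exists x : nat -> X, forall k, x k = F k x.
Proof.
move=> FE.
pose fix tab n := if n is m.+1 then rcons (tab m) (F m (nth x0 (tab m))) else [::].
have stab n : size (tab n) = n by elim: n => //= n IH; rewrite size_rcons IH.
have nthtab n m k : (k < n)%N -> (n <= m)%N -> nth x0 (tab m) k = nth x0 (tab n) k.
  move=> kn; elim: m => [|m IH]; first by rewrite leqn0 => /eqP n0; rewrite n0 in kn.
  rewrite leq_eqVlt => /orP[/eqP ->//|]; rewrite ltnS => nm /=.
  by rewrite nth_rcons stab (leq_trans kn nm) IH.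
exists (fun k => nth x0 (tab k.+1) k) => k.
rewrite /= nth_rcons stab ltnn eqxx; apply: FE => j jk.
by rewrite -(nthtab j.+1 k).
Qed.

Lemma convol_inv {K : fieldType} (a : nat -> K) :
  a 0%N != 0 -> exists b, convol a b = coefs 1.
Proof.
move=> a0.
have [|b bE] := @strong_rec K 0 (fun k b => (a 0%N)^-1 *
    (coefs 1 k - \sum_(i < k) a i.+1 * b (k - i.+1)%N)).
  move=> k x y xy; congr (_ * (_ - _)); apply: eq_bigr => i _.
  by rewrite xy // ltn_subrL /= (leq_ltn_trans _ (ltn_ord i)).
exists b; apply/funext => k; rewrite /convol big_ord_recl /= subn0 {1}bE mulVKf //.
by rewrite subrK.
Qed.

(** * Absolute summability of stable responses *)

Section L1.
Variable R : realType.
Implicit Types (x y : nat -> R[i]).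

Definition abs_summable x := exists B, forall N, \sum_(k < N) normc (x k) <= B.

Lemma normc_ge0 (z : R[i]) : 0 <= normc z.
Proof. by case: z => a b; rewrite /= sqrtr_ge0. Qed.

Lemma sqmodE (z : R[i]) : sqmod z = normc z ^+ 2.
Proof. by case: z => a b; rewrite /= sqr_sqrtr // addr_ge0 // sqr_ge0. Qed.

Lemma abs_summable_coefs (a : {poly R[i]}) : abs_summable (coefs a).
Proof.
exists (\sum_(k < size a) normc (coefs a k)) => N.
apply: (@le_trans _ _ (\sum_(k < N + size a) normc (coefs a k))).
  by rewrite big_split_ord lerDl sumr_ge0 // => i _; exact: normc_ge0.
rewrite addnC big_split_ord /= [X in _ + X]big1 ?addr0 // => i _.
by rewrite /coefs nth_default ?leq_addr // ComplexField.Normc.normc0.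
Qed.

(* [x_k = (x_(k-1) - y_k) / rho], so the partial sums [A] of [|x|] satisfy
   [A <= (A + Y) / |rho|]. *)
Lemma abs_summable_XsubC (rho : R[i]) x y : 1 < normc rho ->
  convol (coefs ('X - rho%:P)) x = y -> abs_summable y -> abs_summable x.
Proof.
move=> rho1 xy [Y hY].
have rho0 : rho != 0.
  by apply: contraTneq rho1 => ->; rewrite ComplexField.Normc.normc0 ltr10.
have x0E : x 0%N = - y 0%N / rho.
  have := congr1 (@^~ 0%N) xy; rewrite /convol big_ord1 /= subn0 /coefs coefB coefX coefC /= sub0r.
  by move=> <-; rewrite [- rho * _]mulNr opprK mulrC mulKf.
have xSE k : x k.+1 = (x k - y k.+1) / rho.
  have := congr1 (@^~ k.+1) xy; rewrite /convol !big_ord_recl big1 => [|i _]; last first.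
    by rewrite /coefs coefB coefX coefC /= subr0 mul0r.
  rewrite /= /coefs !coefB !coefX !coefC /= subn0 subr0 mul1r addr0 sub0r /bump /= add1n subSS subn0.
  by move=> <-; rewrite [- rho * _]mulNr opprD opprK addrCA subrr addr0 mulrC mulKf.
set r := (normc rho)^-1.
have r0 : 0 < r by rewrite invr_gt0 (lt_trans ltr01).
have r1 : r < 1 by rewrite invf_lt1 // (lt_trans ltr01).
have Y0 : 0 <= Y by have := hY 0%N; rewrite big_ord0.
exists (r * Y / (1 - r)) => N.
rewrite ler_pdivlMr ?subr_gt0 // mulrBr mulr1 lerBlDr.
have : \sum_(k < N) normc (x k) <= r * (\sum_(k < N.-1) normc (x k) + \sum_(k < N) normc (y k)).
  case: N => [|N]; first by rewrite !big_ord0 addr0 mulr0.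
  rewrite big_ord_recl [X in _ * (_ + X)]big_ord_recl /= addrCA mulrDr lerD //.
    by rewrite x0E ComplexField.Normc.normcM ComplexField.Normc.normcV normcN mulrC.
  rewrite -big_split mulr_sumr; apply: ler_sum => i _.
  rewrite xSE ComplexField.Normc.normcM ComplexField.Normc.normcV mulrC ler_pM2l //.
  by rewrite -(normcN (y _)) le_normcD.
move=> h; apply: (le_trans h); rewrite mulrDr addrC lerD //.
  by rewrite ler_pM2l.
rewrite mulrC ler_pM2r //.
case: N {h} => [|N] //=.
by rewrite big_ord_recr /= lerDl normc_ge0.
Qed.

Lemma abs_summable_prod (rs : seq R[i]) x y :
  (forall z, z \in rs -> 1 < normc z) ->
  convol (coefs (\prod_(z <- rs) ('X - z%:P))) x = y ->
  abs_summable y -> abs_summable x.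
Proof.
elim: rs x y => [|rho rs IH] x y hrs; first by rewrite big_nil convol1 => ->.
rewrite big_cons -convol_coefs -convolA => xy hy.
apply: (IH x _ _ erefl); first by move=> z zrs; apply: hrs; rewrite in_cons zrs orbT.
by apply: abs_summable_XsubC xy hy; apply: hrs; rewrite mem_head.
Qed.

Definition disc_free (d : {poly R}) :=
  d != 0 /\ forall q : R[i], sqmod q <= 1 -> ~~ root (cpoly d) q.

Lemma disc_free_factor (d : {poly R}) : disc_free d ->
  exists (c : R[i]) (rs : seq R[i]), [/\ c != 0,
    cpoly d = c *: \prod_(z <- rs) ('X - z%:P) &
    forall z, z \in rs -> 1 < normc z].
Proof.
move=> [d0 hd]; have [rs dE] := closed_field_poly_normal (cpoly d).
have c0 : lead_coef (cpoly d) != 0 by rewrite lead_coef_eq0 map_poly_eq0.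
exists (lead_coef (cpoly d)), rs; split => // z zrs; rewrite ltNge; apply/negP => z1.
have /hd/negP : sqmod z <= 1 by rewrite sqmodE expr_le1 // normc_ge0.
by apply; rewrite dE rootZ // root_prod_XsubC.
Qed.

(** Over the complex numbers [d] splits into linear factors with roots outside the closed disc;
    dividing the polynomial [n] by them one at a time keeps absolute summability. *)
Lemma disc_free_abs_summable (d n : {poly R}) (g : nat -> R) : disc_free d ->
  convol (coefs d) g = coefs n ->
  exists B, forall N, \sum_(k < N) `|g k| <= B.
Proof.
move=> /disc_free_factor[c [rs [c0 dE hrs]]] dg.
pose gc k : R[i] := real_complex R (g k).
have : convol (coefs (\prod_(z <- rs) ('X - z%:P))) gc = coefs (c^-1 *: cpoly n).
  have -> : \prod_(z <- rs) ('X - z%:P) = c^-1 *: cpoly d.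
    by rewrite dE scalerA mulVf // scale1r.
  apply/funext => k; rewrite /coefs coefZ coef_map /=.
  have /(congr1 (@^~ k)) := dg; rewrite /coefs => <-.
  rewrite /convol rmorph_sum mulr_sumr; apply: eq_bigr => i _.
  by rewrite coefZ coef_map rmorphM mulrA.
move=> /abs_summable_prod -/(_ hrs (abs_summable_coefs _))[B hB].
exists B => N; apply: le_trans (hB N); apply: ler_sum => k _.
by rewrite /gc /= expr0n /= addr0 sqrtr_sqr.
Qed.

Lemma disc_free_lower_bound (d : {poly R}) : disc_free d ->
  exists2 e, 0 < e & forall q : R[i], normc q = 1 -> e <= normc (cpoly d).[q].
Proof.
move=> /disc_free_factor[c [rs [c0 dE hrs]]].
have cn : 0 < normc c.
  by rewrite lt_def normc_ge0 andbT; apply: contra c0 => /eqP/ComplexField.Normc.eq0_normc ->.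
(* On the unit circle each linear factor satisfies [|q - z| >= |z| - 1 > 0]. *)
exists (normc c * \prod_(z <- rs) (normc z - 1)).
  rewrite mulr_gt0 // big_seq prodr_gt0 // => z /hrs; by rewrite subr_gt0.
move=> q q1; rewrite dE hornerZ ComplexField.Normc.normcM ler_pM2l //.
rewrite horner_prod (big_morph _ (@ComplexField.Normc.normcM R) (ComplexField.Normc.normc1 R)).
rewrite big_seq [leRHS]big_seq; apply: ler_prod => z zrs.
rewrite subr_ge0 ltW ?hrs //= hornerXsubC lerBlDr.
rewrite -(normcN (q - z)) opprB -[in leRHS]q1.
by apply: le_trans (le_normcD _ _); rewrite subrK.
Qed.

End L1.

(** * Parseval's identity for stable rational functions *)

Lemma Rintegral_bigsum {d} {T : measurableType d} {R : realType}
    (mu : {measure set T -> \bar R}) (D : set T) (I : finType) (F : I -> T -> R) :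
  measurable D -> (forall i, mu.-integrable D (EFin \o F i)) ->
  \int[mu]_(t in D) (\sum_i F i t) = \sum_i \int[mu]_(t in D) F i t.
Proof.
move=> mD iF; rewrite /Rintegral; under eq_integral do rewrite -sumEFin.
rewrite integral_sum // sum_fine // => i _.
by apply: integrable_fin_num => //; exact: iF.
Qed.

Lemma integrable_bigsum {d} {T : measurableType d} {R : realType}
    (mu : {measure set T -> \bar R}) (D : set T) (I : finType) (F : I -> T -> R) :
  measurable D -> (forall i, mu.-integrable D (EFin \o F i)) ->
  mu.-integrable D (EFin \o (fun t => \sum_i F i t)).
Proof.
move=> mD iF; rewrite (_ : EFin \o _ = (fun t => \sum_i (F i t)%:E)).
  by apply: integrable_sum => // i _; exact: iF.
by apply/funext => t /=; rewrite sumEFin.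
Qed.

Section Parseval.
Variable R : realType.
Implicit Types (a n d : {poly R}) (t : R).

Local Notation leb := (@lebesgue_measure R).
Local Notation period := (`[(- pi)%R, pi%R]%classic).

(** The value of [q] at the angle [t], in the very form in which [WT_resp] computes it. *)
Definition circ t : R[i] := (Complex (cos t) (sin t))^-1.

Lemma circE t : circ t = Complex (cos t) (- sin t).
Proof. by rewrite /circ /GRing.inv /= cos2Dsin2 !divr1. Qed.

Lemma normc_circ t : normc (circ t) = 1.
Proof. by rewrite circE /= sqrrN cos2Dsin2 sqrtr1. Qed.

Lemma circX t k : circ t ^+ k = Complex (cos (k%:R * t)) (- sin (k%:R * t)).
Proof.
elim: k => [|k IH]; first by rewrite expr0 mul0r cos0 sin0 oppr0.
rewrite exprS IH circE -natr1 mulrDl mul1r cosD sinD.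
by apply/eqP; rewrite eq_complex /=; apply/andP; split; apply/eqP; ring.
Qed.

Lemma sum_complex (I : finType) (F G : I -> R) :
  \sum_i Complex (F i) (G i) = Complex (\sum_i F i) (\sum_i G i).
Proof.
apply: (big_rec3 (fun x y z => x = Complex y z)) => // i x y z _ ->.
by apply/eqP; rewrite eq_complex /= !eqxx.
Qed.

Lemma horner_circ {a} t {N} : (size a <= N)%N ->
  (cpoly a).[circ t] = Complex (\sum_(i < N) a`_i * cos (i%:R * t))
                               (\sum_(i < N) - (a`_i * sin (i%:R * t))).
Proof.
move=> aN; rewrite (@horner_coef_wide _ N) ?size_map_poly // -sum_complex.
apply: eq_bigr => i _; rewrite coef_map circX.
by apply/eqP; rewrite eq_complex /=; apply/andP; split; apply/eqP; ring.
Qed.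

Lemma sqmod_circ {a} t {N} : (size a <= N)%N ->
  sqmod (cpoly a).[circ t] =
  \sum_(i < N) \sum_(j < N) a`_i * a`_j * cos ((i%:R - j%:R) * t).
Proof.
move=> aN; rewrite (horner_circ t aN) /= sumrN sqrrN !expr2 !big_distrlr /=.
rewrite -big_split; apply: eq_bigr => i _; rewrite -big_split; apply: eq_bigr => j _.
by rewrite /= mulrBl cosB; ring.
Qed.

Lemma continuous_cosM (c : R) : continuous (fun t => cos (c * t)).
Proof.
move=> t; apply: continuous_comp; last exact: continuous_cos.
by apply: cvgM; [exact: cvg_cst | exact: cvg_id].
Qed.

Lemma cvg_sum_fin {T : Type} {Fi : set_system T} {FF : Filter Fi}
    (I : finType) (F : I -> T -> R) (l : I -> R) :
  (forall i, F i x @[x --> Fi] --> l i) ->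
  (\sum_i F i x) @[x --> Fi] --> \sum_i l i.
Proof.
move=> h; rewrite (_ : (fun x => _) = \sum_i F i); last first.
  by apply/funext => x; rewrite fct_sumE.
apply: (big_ind2 (fun (f : T -> R) (l : R) => f x @[x --> Fi] --> l)) => //.
- exact: cvg_cst.
- by move=> f1 l1 f2 l2 h1 h2; apply: cvgD.
Qed.

Lemma continuous_sqmod_circ a : continuous (fun t => sqmod (cpoly a).[circ t]).
Proof.
rewrite (_ : (fun t => _) = (fun t => \sum_(i < size a) \sum_(j < size a)
  a`_i * a`_j * cos ((i%:R - j%:R) * t))); last first.
  by apply/funext => t; rewrite (sqmod_circ t (leqnn _)).
move=> t; apply: cvg_sum_fin => i; apply: cvg_sum_fin => j.
apply: cvgM; first exact: cvg_cst.
exact: continuous_cosM.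
Qed.

Lemma continuous_integrable_period (f : R -> R) : continuous f ->
  leb.-integrable period (EFin \o f).
Proof.
move=> cf; apply: continuous_compact_integrable; first exact: segment_compact.
exact: continuous_subspaceT.
Qed.

Lemma leb_period : leb period = (2 * pi)%:E.
Proof.
rewrite lebesgue_measure_itv /= lte_fin gt0_cp ?pi_gt0 // ?EFinB -?EFinD.
by congr (_%:E); rewrite opprK; ring.
Qed.

Lemma Rintegral_cos (c : R) : c != 0 -> sin (c * pi) = 0 ->
  \int[leb]_(t in period) cos (c * t) = 0.
Proof.
move=> c0 sc.
have dF (t : R) : is_derive t 1 (fun t => c^-1 * sin (c * t)) (cos (c * t)).
  have dc : is_derive t 1 (fun t => c * t) c.
    by apply: is_derive_eq; rewrite /GRing.scale /= mulr1.
  have ds : is_derive t 1 (fun t => sin (c * t)) (cos (c * t) * c).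
    exact: (@is_derive1_comp _ sin (fun t => c * t)).
  have dz := is_deriveZ c^-1 ds.
  apply: (is_derive_eq dz).
  by rewrite /GRing.scale /= mulrCA mulVf // mulr1.
have cF : continuous (fun t : R => c^-1 * sin (c * t)).
  move=> t; apply: differentiable_continuous; apply/derivable1_diffP.
  by apply: (@ex_derive _ _ _ _ _ _ _ (dF t)).
rewrite /Rintegral (@continuous_FTC2 _ _ (fun t => c^-1 * sin (c * t))) /=.
- by rewrite mulrN sinN sc mulrN !mulr0 oppr0 subrr.
- by rewrite gt0_cp // pi_gt0.
- by apply: continuous_subspaceT; exact: continuous_cosM.
- split; first by move=> t _; exact: (@ex_derive _ _ _ _ _ _ _ (dF t)).
  + by apply: cvg_at_right_filter; exact: cF.
  + by apply: cvg_at_left_filter; exact: cF.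
- by move=> t _; rewrite derive1E; exact: derive_val.
Qed.

Lemma sin_natpi k : sin (k%:R * pi : R) = 0.
Proof.
elim: k => [|k IH]; first by rewrite mul0r sin0.
by rewrite -natr1 mulrDl mul1r sinDpi IH oppr0.
Qed.

Lemma Rintegral_cos_nat (i j : nat) :
  \int[leb]_(t in period) cos ((i%:R - j%:R) * t) = (i == j)%:R * (2 * pi).
Proof.
have [->|ij] := eqVneq i j.
  rewrite (_ : (fun t => _) = cst 1); last by apply/funext => t; rewrite subrr mul0r cos0.
  rewrite Rintegral_cst; last exact: measurable_itv.
  by congr (_ * _); rewrite -[RHS]/(fine (2 * pi)%:E); congr fine; exact: leb_period.
rewrite mul0r Rintegral_cos //; first by rewrite subr_eq0 eqr_nat.
by rewrite mulrBl sinB !sin_natpi mulr0 mul0r subrr.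
Qed.

Lemma Rintegral_sum_fin (I : finType) (F : I -> R -> R) :
  (forall i, continuous (F i)) ->
  \int[leb]_(t in period) (\sum_i F i t) = \sum_i \int[leb]_(t in period) F i t.
Proof.
by move=> cF; apply: Rintegral_bigsum => // i; exact: continuous_integrable_period.
Qed.

(** Cosines of distinct frequencies integrate to zero over the period, so only the diagonal of the
    double sum survives. *)
Lemma Rintegral_sqmod_circ a :
  \int[leb]_(t in period) sqmod (cpoly a).[circ t] =
  2 * pi * \sum_(i < size a) a`_i ^+ 2.
Proof.
rewrite (_ : (fun t => _) = (fun t => \sum_(i < size a) \sum_(j < size a)
  a`_i * a`_j * cos ((i%:R - j%:R) * t))); last first.
  by apply/funext => t; rewrite (sqmod_circ t (leqnn _)).
have cc (i j : 'I_(size a)) : continuous (fun t : R => a`_i * a`_j * cos ((i%:R - j%:R) * t)).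
  by move=> t; apply: cvgM; [exact: cvg_cst | exact: continuous_cosM].
rewrite Rintegral_sum_fin => [|i t]; last by apply: cvg_sum_fin => j; exact: cc.
rewrite mulr_sumr; apply: eq_bigr => i _.
rewrite Rintegral_sum_fin //.
have ic (j : 'I_(size a)) : leb.-integrable period (EFin \o (fun t => cos ((i%:R - j%:R) * t))).
  by apply: continuous_integrable_period; exact: continuous_cosM.
rewrite (bigD1 i) //= big1 => [|j ji]; rewrite RintegralZl // Rintegral_cos_nat.
- by rewrite eqxx mul1r expr2 mulrC addr0.
- by rewrite eq_sym val_eqE (negbTE ji) mul0r mulr0.
Qed.

End Parseval.

Section Parseval2.
Variable R : realType.
Implicit Types (a n d : {poly R}) (t : R) (g : nat -> R).

Local Notation leb := (@lebesgue_measure R).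
Local Notation period := (`[(- pi)%R, pi%R]%classic).

Lemma normc_real (x : R) : normc (real_complex R x) = `|x|.
Proof. by rewrite /= expr0n /= addr0 sqrtr_sqr. Qed.

Lemma normc_sum (I : finType) (F : I -> R[i]) :
  normc (\sum_i F i) <= \sum_i normc (F i).
Proof.
apply: (big_ind2 (fun x y => normc x <= y)) => //; first by rewrite ComplexField.Normc.normc0.
by move=> x1 y1 x2 y2 h1 h2; apply: (le_trans (le_normcD _ _)); exact: lerD.
Qed.

Lemma normcX (z : R[i]) k : normc (z ^+ k) = normc z ^+ k.
Proof.
elim: k => [|k IH]; first by rewrite !expr0 ComplexField.Normc.normc1.
by rewrite !exprS ComplexField.Normc.normcM IH.
Qed.

Lemma normc_horner_circ a t {N} : (size a <= N)%N ->
  normc (cpoly a).[circ t] <= \sum_(i < N) `|a`_i|.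
Proof.
move=> aN; rewrite (@horner_coef_wide _ N) ?size_map_poly //.
apply: (le_trans (normc_sum _)); apply: ler_sum => i _.
by rewrite ComplexField.Normc.normcM normcX normc_circ expr1n mulr1 coef_map normc_real.
Qed.

Lemma summable_cvg0 g B : (forall N, \sum_(k < N) `|g k| <= B) ->
  forall e, 0 < e -> exists K, forall k, (K <= k)%N -> `|g k| <= e.
Proof.
move=> hB e e0.
have : cvgn (series (fun k => `|g k|)).
  apply: nondecreasing_is_cvgn.
    by apply: nondecreasing_series => k _ _; exact: normr_ge0.
  by exists B => _ [N _ <-]; rewrite /series /= big_mkord.
move=> /cvg_series_cvg_0 /cvgrPdist_le /(_ e e0)[K _ hK].
by exists K => k Kk; have := hK k Kk; rewrite sub0r normrN normr_id.
Qed.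

(** Multiplying the error by [d] keeps it a polynomial. As [d * g = n], its coefficients below [N]
    vanish; the at most [size d] others combine coefficients of [d] with late, hence small, values
    of [g]. *)
Lemma truncation_error {d n g} : disc_free d ->
  convol (coefs d) g = coefs n -> forall e, 0 < e ->
  exists N0, forall N, (N0 <= N)%N -> forall t,
    normc ((cpoly n).[circ t] - (cpoly d).[circ t] * (cpoly (\poly_(k < N) g k)).[circ t]) <= e.
Proof.
move=> cd dg e e0.
have [B hB] := disc_free_abs_summable cd dg.
have [A hA] := abs_summable_coefs (cpoly d).
have {}hA N : \sum_(k < N) `|d`_k| <= A.
  apply: le_trans (hA N); apply: ler_sum => k _.
  by rewrite /coefs coef_map normc_real.
have A0 : 0 <= A by have := hA 0%N; rewrite big_ord0.
(* The [D] surviving coefficients are each at most [A * eta]; the [+ 1] keeps the denominator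
   positive. *)
pose D := size d; pose eta := e / (D%:R * A + 1).
have DA : 0 < D%:R * A + 1 by rewrite ltr_wpDl // mulr_ge0.
have eta0 : 0 < eta by rewrite divr_gt0.
have [K hK] := summable_cvg0 hB eta0.
exists (maxn (K + D) (size n)) => N; rewrite geq_max => /andP[KN nN] t.
pose gN := \poly_(k < N) g k; pose r := n - d * gN.
have -> : (cpoly n).[circ t] - (cpoly d).[circ t] * (cpoly gN).[circ t] =
          (cpoly r).[circ t].
  by rewrite /r /cpoly rmorphB rmorphM hornerD hornerN hornerM.
have sr : (size r <= N + D)%N.
  rewrite (leq_trans (size_polyD _ _)) // geq_max size_polyN (leq_trans nN (leq_addr _ _)) /=.
  apply: (leq_trans (size_polyMleq _ _)); apply: (leq_trans (leq_pred _)).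
  by rewrite addnC leq_add2r size_poly.
apply: (le_trans (normc_horner_circ t sr)).
rewrite big_split_ord /= big1 ?add0r => [|i _]; last first.
  have /(congr1 (@^~ (i : nat))) := dg; rewrite /coefs /r coefB => <-.
  rewrite coefM /convol -sumrB big1 ?normr0 // => -[j /= ji] _.
  by rewrite /gN coef_poly (leq_ltn_trans (leq_subr _ _)) // subrr.
apply: (@le_trans _ _ (\sum_(i < D) (A * eta))); last first.
  rewrite sumr_const card_ord -mulr_natl mulrA /eta mulrA ler_pdivrMr // mulrC.
  by rewrite ler_pM2l // lerDl ler01.
apply: ler_sum => -[j /= jD] _.
rewrite /r coefB nth_default ?sub0r ?normrN; last by rewrite (leq_trans nN) // leq_addr.
rewrite coefM; apply: (le_trans (ler_norm_sum _ _ _)).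
apply: (@le_trans _ _ (\sum_(i < (N + j).+1) (`|d`_i| * eta))); last first.
  by rewrite -mulr_suml ler_pM2r.
apply: ler_sum => -[i /= ij] _; rewrite normrM.
have [iD|Di] := ltnP i D; last first.
  by rewrite nth_default // normr0 !mul0r.
apply: ler_wpM2l => //; rewrite /gN coef_poly; case: ifP => _; last by rewrite normr0 ltW.
apply: hK; clearbody D; clear -KN iD; lia.
Qed.

(** The identity is exact for the truncations of [g], and their squared moduli converge uniformly on
    the circle to that of [n / d], so the integrals converge. *)
Lemma parseval_rat {d n g} : disc_free d ->
  convol (coefs d) g = coefs n ->
  (\sum_(k < N) g k ^+ 2) @[N --> \oo] -->
  (2 * pi)^-1 * \int[leb]_(t in period) (sqmod (cpoly n).[circ t] / sqmod (cpoly d).[circ t]).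
Proof.
move=> cd dg.
have [B hB] := disc_free_abs_summable cd dg.
have B0 : 0 <= B by have := hB 0%N; rewrite big_ord0.
have [c c0 hc] := disc_free_lower_bound cd.
have pi2 : 0 < 2 * pi :> R by rewrite mulr_gt0 // pi_gt0.
have dne t : sqmod (cpoly d).[circ t] != 0.
  by rewrite sqmodE sqrf_eq0 gt_eqF // (lt_le_trans c0) // hc // normc_circ.
pose F t := sqmod (cpoly n).[circ t] / sqmod (cpoly d).[circ t].
have cF : continuous F.
  move=> t; apply: cvgM; first exact: continuous_sqmod_circ.
  by apply: cvgV; [exact: dne | exact: continuous_sqmod_circ].
apply/cvgrPdist_le => e e0.
(* If [|x - y| <= del <= 1] and [|y| <= B], then [|x|^2] and [|y|^2] differ by at most
   [del * (2 * B + 1)]. The truncation error is asked to be below [del * c] because it is still to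
   be divided by [d], which is at least [c] on the circle. *)
pose del := Num.min 1 (e / (2 * B + 1)).
have B1 : 0 < 2 * B + 1 by rewrite ltr_wpDl // mulr_ge0.
have del0 : 0 < del by rewrite lt_min ltr01 divr_gt0.
have [N0 hN0] := truncation_error cd dg (mulr_gt0 del0 c0).
exists N0 => // N /= NN.
pose G t := sqmod (cpoly (\poly_(k < N) g k)).[circ t].
have cG : continuous G by exact: continuous_sqmod_circ.
have FG t : `|F t - G t| <= e.
  set x := (cpoly n).[circ t] / (cpoly d).[circ t].
  set y := (cpoly (\poly_(k < N) g k)).[circ t].
  have -> : F t = normc x ^+ 2.
    by rewrite /F /x !sqmodE ComplexField.Normc.normcM ComplexField.Normc.normcV exprMn exprVn.
  have -> : G t = normc y ^+ 2 by rewrite /G sqmodE.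
  have xy : normc (x - y) <= del.
    have d0 : (cpoly d).[circ t] != 0.
      by apply: contra (dne t) => /eqP ->; rewrite sqmodE ComplexField.Normc.normc0 expr0n.
    have -> : x - y = ((cpoly n).[circ t] - (cpoly d).[circ t] * y) / (cpoly d).[circ t].
      by rewrite mulrBl -/x mulrAC divff // mul1r.
    rewrite ComplexField.Normc.normcM ComplexField.Normc.normcV ler_pdivrMr.
      apply: (le_trans (hN0 N NN t)); rewrite ler_pM2l //.
      by rewrite hc // normc_circ.
    by rewrite (lt_le_trans c0) // hc // normc_circ.
  have yB : normc y <= B.
    apply: (le_trans (normc_horner_circ _ (size_poly _ _))).
    apply: le_trans (hB N); apply: ler_sum => i _.
    by rewrite coef_poly ltn_ord.
  have x1 : normc x <= normc y + normc (x - y).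
    by have := le_normcD y (x - y); rewrite addrC subrK.
  have x2 : normc y <= normc x + normc (x - y).
    by have := le_normcD x (y - x); rewrite addrC subrK -(normcN (y - x)) opprB.
  have x0 := normc_ge0 x; have y0 := normc_ge0 y.
  have d1 : del <= 1 by rewrite ge_min lexx.
  have de : del * (2 * B + 1) <= e.
    by rewrite -ler_pdivlMr // ge_min lexx orbT.
  rewrite subr_sqr normrM.
  have h1 : `|normc x - normc y| <= del by rewrite ler_norml; apply/andP; split; lra.
  have h2 : `|normc x + normc y| <= 2 * B + 1 by rewrite ger0_norm; lra.
  apply: le_trans de; exact: ler_pM.
have -> : \sum_(k < N) g k ^+ 2 = (2 * pi)^-1 * \int[leb]_(t in period) G t.
  rewrite Rintegral_sqmod_circ mulKf ?gt_eqF //.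
  set a := \poly_(k < N) g k.
  have aN : (size a <= N)%N by exact: size_poly.
  rewrite (big_ord_widen _ (fun i => a`_i ^+ 2) aN) [RHS]big_mkcond.
  apply: eq_bigr => i _; case: ifP => [_|/negbT]; first by rewrite coef_poly ltn_ord.
  rewrite -leqNgt => ai; have : a`_i = 0 by rewrite nth_default.
  by rewrite coef_poly ltn_ord => ->; rewrite expr0n.
have iF := continuous_integrable_period cF; have iG := continuous_integrable_period cG.
have mp : measurable (period : set (measurableTypeR R)) by exact: measurable_itv.
rewrite -mulrBr -RintegralB // normrM gtr0_norm ?invr_gt0 // ler_pdivrMl //.
have cFG : continuous (fun t => F t - G t) by move=> t; apply: cvgB; [exact: cF | exact: cG].
apply: (le_trans (le_normr_Rintegral _ _)) => //.
  exact: (continuous_integrable_period cFG).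
have cFGn : continuous (fun t => `|F t - G t|).
  by move=> t; apply: cvg_norm; exact: cFG.
apply: (@le_trans _ _ (\int[leb]_(t in period) cst e t)).
  apply: le_Rintegral => //.
  - exact: (continuous_integrable_period cFGn).
  - by apply: continuous_integrable_period => t; exact: cvg_cst.
  - by move=> t _; exact: FG.
rewrite (Rintegral_cst leb mp) mulrC ler_pM2r //.
by rewrite le_eqVlt -[X in _ == X]/(fine (2 * pi)%:E); apply/orP; left; apply/eqP; congr fine; exact: leb_period.
Qed.

End Parseval2.

(** * The H2 norm as a sum of variances *)

(** Sorting by the lag [l.+1] between the two indices matches the way [S_Omega] collects its
    terms. *)
Lemma sum_by_difference {V : zmodType} (F : nat -> nat -> V) n :
  \sum_(i < n) \sum_(j < n) F i j =
  \sum_(i < n) F i i +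
  \sum_(l < n) \sum_(i < n - l.+1) (F i (i + l.+1)%N + F (i + l.+1)%N i).
Proof.
elim: n => [|n IH]; first by rewrite !big_ord0 addr0.
have -> : \sum_(i < n.+1) \sum_(j < n.+1) F i j =
    \sum_(i < n) \sum_(j < n) F i j + F n n + \sum_(i < n) (F i n + F n i).
  rewrite big_ord_recr /= [X in _ + X]big_ord_recr /=.
  under eq_bigr => i _ do rewrite big_ord_recr /=.
  by rewrite !big_split /= -!addrA; congr (_ + _); rewrite addrA addrC.
rewrite IH [in RHS]big_ord_recr /= [X in _ = _ + X]big_ord_recr /=.
rewrite subnn big_ord0 addr0.
rewrite -!addrA; congr (_ + _); rewrite addrCA; congr (_ + _).
(* Reversal indexes the entries of the new row and column by their lag. *)
rewrite [X in _ + X](reindex_inj rev_ord_inj) /= -big_split; apply: eq_bigr => -[l /= ln] _.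
have -> : (n.+1 - l.+1 = (n - l.+1).+1)%N by lia.
rewrite big_ord_recr /=; congr (_ + _).
by have -> : (n - l.+1 + l.+1 = n)%N by lia.
Qed.

Section Spectrum.
Variable R : realType.
Implicit Types (a n d : {poly R}) (t : R) (g : nat -> R).
Variables (tb : nat) (alpha p : nat -> R).

Local Notation leb := (@lebesgue_measure R).
Local Notation period := (`[(- pi)%R, pi%R]%classic).

(* The channel uncertainty [omega(n + i, n)], [i = 0, .., tb], on the event
   [tau_n = s], as a polynomial in [z^-1]. *)
Definition xi (s : nat) : {poly R} :=
  \poly_(i < tb.+1) (alpha i * ((s == i)%:R - p i)).

Definition fvar g (k : nat) : R :=
  \sum_(s < tb.+1) p s * convol (coefs (xi s)) g k ^+ 2.

Hypothesis sum_p : \sum_(s < tb.+1) p s = 1.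

(** These are the covariances of the indicators of the delay values, the ingredients of [rcorr]. *)
Lemma cov_delta (i j : nat) : (i < tb.+1)%N -> (j < tb.+1)%N ->
  \sum_(s < tb.+1) p s * (((s : nat) == i)%:R - p i) * (((s : nat) == j)%:R - p j) =
  (i == j)%:R * p i - p i * p j.
Proof.
move=> ib jb.
have pick k : (k < tb.+1)%N -> forall F : nat -> R,
    \sum_(s < tb.+1) ((s : nat) == k)%:R * F s = F k.
  move=> kb F; rewrite (bigD1 (Ordinal kb)) //= eqxx mul1r big1 ?addr0 // => s sk.
  by rewrite -[_ == k]/(s == Ordinal kb) (negbTE sk) mul0r.
have -> : \sum_(s < tb.+1) p s * (((s : nat) == i)%:R - p i) * (((s : nat) == j)%:R - p j) =
    \sum_(s < tb.+1) ((s : nat) == i)%:R * (p s * ((s : nat) == j)%:R)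
    - \sum_(s < tb.+1) ((s : nat) == i)%:R * (p s * p j)
    - \sum_(s < tb.+1) ((s : nat) == j)%:R * (p s * p i)
    + \sum_(s < tb.+1) p s * (p i * p j).
  by rewrite -!sumrB -big_split; apply: eq_bigr => s _ /=; ring.
rewrite (pick i ib (fun s => p s * (s == j)%:R)) (pick i ib (fun s => p s * p j)).
by rewrite (pick j jb (fun s => p s * p i)) -mulr_suml sum_p; ring.
Qed.

(** The energy spectrum is the mean of [xi(z) xi(1/z)] over the delay: expanding both factors leaves
    the covariances of [cov_delta], which are then sorted by lag. *)
Lemma S_Omega_xi (z : R[i]) : z != 0 ->
  S_Omega tb alpha p z =
  \sum_(s < tb.+1) real_complex R (p s) * ((cpoly (xi s)).[z] * (cpoly (xi s)).[z^-1]).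
Proof.
move=> z0.
pose c i j : R[i] := real_complex R (alpha i * alpha j * ((i == j)%:R * p i - p i * p j)).
transitivity (\sum_(i < tb.+1) \sum_(j < tb.+1) c i j * (z ^+ i * z ^- j)).
  rewrite (sum_by_difference (fun i j => c i j * (z ^+ i * z ^- j))).
  rewrite /S_Omega big_ord_recl /= [X in _ = _ + X]big_ord_recr /= subnn big_ord0 addr0.
  congr (_ + _).
    rewrite /rcorr /= rmorph_sum; apply: eq_bigr => i _.
    rewrite divff ?expf_neq0 // mulr1 /c; congr (real_complex _ _).
    by rewrite eqxx mul1r; ring.
  apply: eq_bigr => -[l /= ltb] _; rewrite /bump /= add1n /rcorr /=.
  rewrite rmorphN rmorph_sum mulNr mulr_suml -sumrN subSS.
  have -> : ((tb - l.+1).+1 = tb - l)%N by lia.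
  apply: eq_bigr => -[i /= il] _; rewrite /c.
  have -> : (i == i + l.+1)%N = false by lia.
  have -> : (i + l.+1 == i)%N = false by lia.
  rewrite exprD !mul0r !sub0r.
  have zi : z ^+ i != 0 by rewrite expf_neq0.
  have -> : z ^+ i * (z ^+ i * z ^+ l.+1)^-1 = z ^- l.+1 by rewrite invfM mulVKf.
  have -> : z ^+ i * z ^+ l.+1 * z ^- i = z ^+ l.+1 by rewrite mulrAC divff // mul1r.
  rewrite mulrDr opprD -!mulNr -!rmorphN.
  by congr (_ * _ + _ * _); congr (real_complex _ _); ring.
have hx s (x : R[i]) : (cpoly (xi s)).[x] =
    \sum_(i < tb.+1) real_complex R (alpha i * ((s == i)%:R - p i)) * x ^+ i.
  rewrite (@horner_coef_wide _ tb.+1) ?size_map_poly ?size_poly //.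
  by apply: eq_bigr => i _; rewrite coef_map coef_poly ltn_ord.
under [RHS]eq_bigr do rewrite !hx big_distrlr mulr_sumr /=.
rewrite [RHS]exchange_big; apply: eq_bigr => i _ /=.
under [RHS]eq_bigr do rewrite mulr_sumr.
rewrite [RHS]exchange_big; apply: eq_bigr => j _ /=.
rewrite /c -cov_delta // mulr_sumr rmorph_sum mulr_suml; apply: eq_bigr => s _.
by rewrite exprVn [X in _ = _ * X]mulrACA [RHS]mulrA -!rmorphM; congr (real_complex _ _ * _); ring.
Qed.

(** On the unit circle inversion is conjugation, and [a] has real coefficients. *)
Lemma sqmod_circ_complex a t :
  real_complex R (sqmod (cpoly a).[circ t]) = (cpoly a).[circ t] * (cpoly a).[(circ t)^-1].
Proof.
have -> : (circ t)^-1 = conjc (circ t).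
  by rewrite circE /circ /GRing.inv /= sqrrN cos2Dsin2 !divr1.
have -> : (cpoly a).[conjc (circ t)] = conjc (cpoly a).[circ t].
  rewrite -[RHS]horner_map /=; congr (_.[_]).
  by apply/polyP => i; rewrite !coef_map /= oppr0.
case: (cpoly a).[_] => x y /=.
by apply/eqP; rewrite eq_complex /=; apply/andP; split; apply/eqP; ring.
Qed.

Lemma sqmod_phi phi t : spectral_factor tb alpha p phi ->
  sqmod (cpoly phi).[circ t] = \sum_(s < tb.+1) p s * sqmod (cpoly (xi s)).[circ t].
Proof.
move=> [_ hS _]; apply: (@complexI R).
have q0 : circ t != 0.
  by apply/eqP => q0; have := normc_circ t; rewrite q0 ComplexField.Normc.normc0 => /eqP; rewrite eq_sym oner_eq0.
rewrite sqmod_circ_complex -hS // S_Omega_xi // rmorph_sum; apply: eq_bigr => s _.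
by rewrite rmorphM /= -sqmod_circ_complex.
Qed.

(** An angle in the period is recovered up to sign from its cosine, so each root accounts for at
    most two angles. *)
Lemma finite_circ_roots a : a != 0 ->
  exists E : set R, [/\ finite_set E & forall t, period t -> root (cpoly a) (circ t) -> E t].
Proof.
move=> a0; have [rs aE] := closed_field_poly_normal (cpoly a).
pose E := (fun z : R[i] => acos (complex.Re z)) @` [set` rs] `|`
          (fun z : R[i] => - acos (complex.Re z)) @` [set` rs].
exists E; split.
  by rewrite finite_setU; split; apply: finite_image; exact: finite_seq.
move=> t; rewrite /= in_itv /= => /andP[t1 t2].
rewrite aE rootZ ?lead_coef_eq0 ?map_poly_eq0 // root_prod_XsubC => trs.
have [t0|t0] := leP 0 t.
  left; exists (circ t) => //; rewrite circE /= cosK // in_itv /=.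
  by rewrite t0.
right; exists (circ t) => //; rewrite circE /= cosKN ?opprK // t1.
exact: ltW.
Qed.

Section Norm.
Variables (bP aP bK aK phi d n : {poly R}) (g : nat -> R).
Let h := Hpoly tb alpha p.
Let chi := char_loop tb alpha p bP aP bK aK.
Hypotheses (aP0 : aP != 0) (aK0 : aK != 0) (chi0 : chi != 0).
Hypotheses (spec : spectral_factor tb alpha p phi) (cd : disc_free d).
Hypotheses (dn : d * (bK * bP) = chi * n) (dg : convol (coefs d) g = coefs n).

(** The integrand with [n / d] in place of [KP / (1 - HKP)]. It is continuous on the whole circle,
    whereas [WT_resp] divides by values of [h], [aP], [aK] and [1 - HKP] that may vanish there. *)
Let G t := \sum_(s < tb.+1)
  p s * (sqmod (cpoly (xi s * n)).[circ t] / sqmod (cpoly d).[circ t]).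

Lemma sqmodM (x y : R[i]) : sqmod (x * y) = sqmod x * sqmod y.
Proof. by rewrite !sqmodE ComplexField.Normc.normcM exprMn. Qed.

Lemma sqmodV (x : R[i]) : sqmod x^-1 = (sqmod x)^-1.
Proof. by rewrite !sqmodE ComplexField.Normc.normcV exprVn. Qed.

Lemma sqmod_d_neq0 t : sqmod (cpoly d).[circ t] != 0.
Proof.
have [_ /(_ (circ t))] := cd.
rewrite sqmodE normc_circ expr1n lexx => /(_ isT).
by apply: contra; rewrite sqmodE sqrf_eq0 => /eqP/ComplexField.Normc.eq0_normc/eqP.
Qed.

Lemma integrandE t : G t =
  sqmod (cpoly phi).[circ t] * (sqmod (cpoly n).[circ t] / sqmod (cpoly d).[circ t]).
Proof.
rewrite (sqmod_phi _ spec) mulr_suml; apply: eq_bigr => s _.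
by rewrite /cpoly rmorphM hornerM sqmodM !mulrA.
Qed.

Lemma WT_respE t : h != 0 -> ~~ root (cpoly (h * aP * aK * chi)) (circ t) ->
  sqmod (WT_resp tb alpha p bP aP bK aK phi t) = G t.
Proof.
move=> h0; rewrite /root /cpoly !rmorphM !hornerM -!/(cpoly _) !mulf_eq0 !negb_or.
set q := circ t => /andP[/andP[/andP[hq aPq] aKq] chiq].
rewrite integrandE -sqmodV -!sqmodM; congr sqmod.
rewrite /WT_resp -/(circ t) -/q -/h.
have dq : (cpoly d).[q] != 0.
  apply: contra (sqmod_d_neq0 t) => /eqP; rewrite -/q => ->.
  by rewrite sqmodE ComplexField.Normc.normc0 expr0n.
have chiE : (cpoly chi).[q] = (cpoly aK).[q] * (cpoly aP).[q]
    - (cpoly h).[q] * (cpoly bK).[q] * (cpoly bP).[q].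
  by rewrite /chi /char_loop /cpoly rmorphB !rmorphM hornerD hornerN !hornerM.
have dnq : (cpoly d).[q] * ((cpoly bK).[q] * (cpoly bP).[q]) = (cpoly chi).[q] * (cpoly n).[q].
  by rewrite -!hornerM /cpoly -!rmorphM dn.
have -> : (cpoly n).[q] / (cpoly d).[q] = (cpoly bK).[q] * (cpoly bP).[q] / (cpoly chi).[q].
  by apply/eqP; rewrite eqr_div // [_ * (cpoly chi).[q]]mulrC -dnq mulrC.
move: chiq; rewrite chiE; move: hq aPq aKq.
move: (cpoly phi).[q] (cpoly h).[q] (cpoly aP).[q] (cpoly aK).[q] (cpoly bK).[q] (cpoly bP).[q].
move=> f x a b c e x0 a0 b0 ch0.
have ch1 : b * a - x * (c * e) != 0 by rewrite mulrA.
field.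
by rewrite ?x0 ?a0 ?b0 ?ch0 ?ch1.
Qed.

Lemma continuous_G : continuous G.
Proof.
move=> t; apply: cvg_sum_fin => s; apply: cvgM; first exact: cvg_cst.
apply: cvgM; first exact: continuous_sqmod_circ.
by apply: cvgV; [exact: sqmod_d_neq0 | exact: continuous_sqmod_circ].
Qed.

Lemma integral_WT_resp :
  (\int[leb]_(t in period) (sqmod (WT_resp tb alpha p bP aP bK aK phi t))%:E =
   \int[leb]_(t in period) (G t)%:E)%E.
Proof.
(* For [h = 0] the convention on division by zero makes [WT_resp] vanish. The other side vanishes
   too: each [alpha i * p i] is zero, which forces [xi s = 0] for every delay [s] of nonzero
   probability. *)
have [h0|h0] := eqVneq h 0.
  apply: eq_integral => t _; congr (_%:E).
  rewrite integrandE /WT_resp -/h -/(circ t) h0 /cpoly rmorph0 horner0 invr0 mulr0 mul0r.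
  rewrite sqmodE ComplexField.Normc.normc0 expr0n /= -!/(cpoly _).
  have ap0 (i : 'I_tb.+1) : alpha i * p i = 0.
    have := congr1 (fun a : {poly R} => a`_i) h0; rewrite /h /Hpoly coef0.
    by rewrite -(poly_def tb.+1 (fun i => alpha i * p i)) coef_poly ltn_ord.
  rewrite (sqmod_phi _ spec) big1 ?mul0r // => s _.
  have [->|ps] := eqVneq (p s) 0; first by rewrite mul0r.
  have -> : xi s = 0.
    apply/polyP => i; rewrite coef_poly coef0; case: ifP => // ib.
    have := ap0 (Ordinal ib) => /= /eqP; rewrite mulf_eq0 => /orP[/eqP ->|/eqP pi0].
      by rewrite mul0r.
    rewrite pi0 subr0; case: eqP => [si|_]; last by rewrite mulr0.
    by move: ps; rewrite si pi0 eqxx.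
  by rewrite /cpoly rmorph0 horner0 sqmodE ComplexField.Normc.normc0 expr0n mulr0.
have [E [fE hE]] : exists E : set R, [/\ finite_set E & forall t, period t ->
    root (cpoly (h * aP * aK * chi)) (circ t) -> E t].
  by apply: finite_circ_roots; rewrite !mulf_neq0.
have cE : countable E by exact: finite_set_countable.
have mE : measurable (E : set (measurableTypeR R)) by exact: countable_measurable.
have mp : measurable (period : set (measurableTypeR R)) by exact: measurable_itv.
have eqE t : period t -> ~ E t -> sqmod (WT_resp tb alpha p bP aP bK aK phi t) = G t.
  by move=> pt Et; apply: WT_respE => //; apply/negP => /(hE _ pt).
have mG (D : set (measurableTypeR R)) : measurable_fun D (G : measurableTypeR R -> R).
  by apply: measurable_funTS; apply: continuous_measurable_fun; exact: continuous_G.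
apply: ae_eq_integral => //; last first.
- exists E; split => //; first exact: countable_lebesgue_measure0.
  move=> t /=; apply: contra_notP => Et pt; congr (_%:E); exact: eqE.
- by apply/measurable_EFinP; exact: mG.
apply/measurable_EFinP.
(* [WT_resp] is measurable piecewise: every subset of the countable set [E] is measurable, and off
   [E] the function is the continuous [G]. *)
have -> : period = (period `&` E) `|` (period `\` (period `&` E)).
  by rewrite setDUK //; exact: subIsetl.
have mpE := measurableI _ _ mp mE.
apply/measurable_funU; [exact: mpE| exact: measurableD|split].
  move=> _ Y mY; apply: countable_measurable => //.
  apply: sub_countable cE; apply: subset_card_le.
  by move=> t [[]].
apply: (eq_measurable_fun G); last exact: mG.
move=> t; rewrite inE => -[pt /not_andP[//|Et]]; by rewrite eqE.
Qed.

(** Parseval's identity is applied for each delay value [s] to the response [xi s] convolved with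
    [g], which is the fraction of [xi s * n] by the same [d]. *)
Lemma H2_sq_cvg : exists F : R, H2_sq tb alpha p bP aP bK aK phi = F%:E /\
  (\sum_(k < N) fvar g k) @[N --> \oo] --> F.
Proof.
have iG : leb.-integrable period (EFin \o G).
  by apply: continuous_integrable_period; exact: continuous_G.
exists ((2 * pi)^-1 * \int[leb]_(t in period) G t); split.
  rewrite /H2_sq integral_WT_resp EFinM; congr (_ * _)%E.
  rewrite /Rintegral fineK //; apply: integrable_fin_num => //; exact: measurable_itv.
pose Gs s t := sqmod (cpoly (xi s * n)).[circ t] / sqmod (cpoly d).[circ t].
have cGs s : continuous (Gs s).
  move=> t; apply: cvgM; first exact: continuous_sqmod_circ.
  by apply: cvgV; [exact: sqmod_d_neq0 | exact: continuous_sqmod_circ].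
have -> : (2 * pi)^-1 * \int[leb]_(t in period) G t =
    \sum_(s < tb.+1) p s * ((2 * pi)^-1 * \int[leb]_(t in period) Gs s t).
  rewrite Rintegral_sum_fin => [|s t]; last by apply: cvgM; [exact: cvg_cst|exact: cGs].
  rewrite mulr_sumr; apply: eq_bigr => s _.
  have := @RintegralZl _ _ R leb period (Gs s) (p s) (measurable_itv _)
    (continuous_integrable_period (cGs s)).
  by rewrite /Gs => ->; rewrite mulrCA.
rewrite (_ : (fun N => _) = (fun N => \sum_(s < tb.+1) p s *
    \sum_(k < N) convol (coefs (xi s)) g k ^+ 2)); last first.
  apply/funext => N; rewrite exchange_big; apply: eq_bigr => s _.
  by rewrite mulr_sumr.
apply: cvg_sum_fin => s; apply: cvgM; first exact: cvg_cst.
apply: parseval_rat => //.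
by rewrite -convol_coefs -dg !convolA [convol (coefs d) _]convolC.
Qed.

End Norm.
End Spectrum.

(** * The closed loop *)

Section Loop.
Variable R : realType.
Variables (tb : nat) (alpha p : nat -> R) (bP aP bK aK : {poly R}).
Let h := Hpoly tb alpha p.
Let chi := char_loop tb alpha p bP aP bK aK.

Lemma lti_eqE (b a : {poly R}) (x y : nat -> R) :
  lti_eq b a x y <-> convol (coefs a) y = convol (coefs b) x.
Proof.
have E (c : {poly R}) (z : nat -> R) k :
    \sum_(i < size c) c`_i * sh z k i = convol (coefs c) z k.
  transitivity (\sum_(i < size c + k.+1) c`_i * sh z k i).
    rewrite big_split_ord /= [X in _ + X]big1 ?addr0 // => i _.
    by rewrite nth_default ?leq_addr // mul0r.
  rewrite addnC big_split_ord /= [X in _ + X]big1 ?addr0 => [|i _].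
    by apply: eq_bigr => i _; rewrite /sh -ltnS ltn_ord.
  by rewrite /sh ifF ?mulr0 //; lia.
split => [hl|hl k]; last by rewrite !E hl.
by apply/funext => k; rewrite -!E; exact: hl.
Qed.

Lemma sum_ord_geq (n k : nat) (F : nat -> R) : (n <= k)%N ->
  \sum_(m < k.+1 | (n <= m)%N) F m = \sum_(i < (k - n).+1) F (n + i)%N.
Proof.
move=> nk.
rewrite -(big_mkord (fun m => (n <= m)%N) F) -(big_mkord xpredT (fun i => F (n + i)%N)).
rewrite (@big_cat_nat _ _ _ n) //=; last by rewrite ltnW.
rewrite big_nat_cond big_pred0 ?add0r => [|m]; last by lia.
transitivity (\sum_(n <= m < k.+1) F m).
  by rewrite big_nat_cond [RHS]big_nat_cond; apply: eq_bigl => m; lia.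
rewrite -{1}[n]add0n big_addn subSn //.
by apply: eq_bigr => i _; rewrite addnC.
Qed.

(** The term of index [n] is [F n] delayed by [n], and convolution commutes with delays. *)
Lemma convol_triangular (g : nat -> R) (F : nat -> nat -> R) k :
  convol g (fun m => \sum_(n < m.+1) F n (m - n)%N) k =
  \sum_(n < k.+1) convol (F n) g (k - n)%N.
Proof.
rewrite convolC /convol.
under eq_bigr => m _.
  rewrite mulr_suml (big_ord_widen k.+1 (fun n => F n (m - n)%N * g (k - m)%N)) //.
  rewrite big_mkcond; over.
rewrite exchange_big /=; apply: eq_bigr => -[n /= nk] _.
rewrite -big_mkcond /=.
under eq_bigl => m do rewrite ltnS.
rewrite (sum_ord_geq (fun m => F n (m - n)%N * g (k - m)%N)) //.
apply: eq_bigr => i _; rewrite addKn; congr (_ * g _).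
by rewrite subnDA.
Qed.

Hypotheses (aP0 : aP`_0 != 0) (aK0 : aK`_0 != 0) (bP0 : bP`_0 = 0).

(** Strict properness of the plant gives [kap 0 = 0], so [u k] depends on strictly earlier values
    and the loop is a causal recursion, solvable along every path of delays. Necessity relies on it,
    since stability speaks of given solutions. *)
Lemma loop_eqs_exists (v : nat -> R) (tau : nat -> 'I_tb.+1) :
  exists yuud : (nat -> R) * (nat -> R) * (nat -> R),
    loop_eqs alpha bP aP bK aK v tau yuud.1.1 yuud.1.2 yuud.2.
Proof.
have [ia iaE] := @convol_inv _ (coefs aP) aP0.
have [ik ikE] := @convol_inv _ (coefs aK) aK0.
pose gP := convol ia (coefs bP); pose gK := convol ik (coefs bK).
pose kap := convol gK gP.
pose fud (u : nat -> R) k := \sum_(i < tb.+1)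
  (if (i <= k)%N then alpha i * (tau (k - i)%N == i :> nat)%:R * u (k - i)%N else 0).
have kap0 : kap 0%N = 0.
  by rewrite /kap /gP /convol !big_ord1 /= /coefs bP0 !mulr0.
have [u uE] : exists u, forall k, u k = convol kap (fun m => v m + fud u m) k.
  have [|u uE] := @strong_rec R 0 (fun k u => \sum_(i < k) kap i.+1 * (v (k - i.+1)%N + fud u (k - i.+1)%N)).
    move=> k x y xy; apply: eq_bigr => -[i /= ik'] _; congr (_ * (_ + _)).
    apply: eq_bigr => j _; case: ifP => // jk; rewrite xy //; lia.
  exists u => k; rewrite uE /convol big_ord_recl kap0 mul0r add0r.
  by apply: eq_bigr => i _.
pose y := convol gP (fun m => v m + fud u m).
exists (y, u, fud u); split => //=.
  apply/lti_eqE; rewrite /y /gP convolA [convol (coefs aP) _]convolA iaE convol1 //.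
apply/lti_eqE.
have -> : u = convol kap (fun m => v m + fud u m) by apply/funext.
by rewrite /kap -convolA -/y /gK convolA [convol (coefs aK) _]convolA ikE convol1.
Qed.

Variables (d n : {poly R}) (g : nat -> R).
Hypothesis d0 : d`_0 != 0.
Hypotheses (dn : d * (bK * bP) = chi * n) (dg : convol (coefs d) g = coefs n).

Lemma chi0 : chi`_0 != 0.
Proof.
by rewrite /chi /char_loop coefB !coef0M bP0 mulr0 subr0 mulf_neq0.
Qed.

Lemma g0 : g 0%N = 0.
Proof.
have n0 : n`_0 = 0.
  have := congr1 (fun a : {poly R} => a`_0) dn; rewrite !coef0M bP0 !mulr0 => /esym/eqP.
  by rewrite mulf_eq0 (negbTE chi0) => /eqP.
have := congr1 (@^~ 0%N) dg; rewrite /convol big_ord1 /coefs n0 => /eqP.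
by rewrite mulf_eq0 (negbTE d0) => /eqP.
Qed.

(* The gain from [u n] to [u (n + j)] through the channel uncertainty when the
   delay at time [n] is [s]. *)
Definition gain (j s : nat) : R := convol (coefs (xi tb alpha p s)) g j.

Lemma loop_eqs_rec (v : nat -> R) (tau : nat -> 'I_tb.+1) (y u ud : nat -> R) :
  loop_eqs alpha bP aP bK aK v tau y u ud ->
  forall k, u k = convol g v k + \sum_(m < k) gain (k - m) (tau m) * u m.
Proof.
move=> [/lti_eqE Py /lti_eqE Ku udE].
pose e k := \sum_(m < k.+1) (xi tb alpha p (tau m))`_(k - m) * u m.
have udE' : ud = (fun k => convol (coefs h) u k + e k).
  apply/funext => k; rewrite udE.
  have -> : \sum_(i < tb.+1) (if (i <= k)%N then
        alpha i * (tau (k - i)%N == i :> nat)%:R * u (k - i)%N else 0) =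
      \sum_(i < k.+1) (if (i < tb.+1)%N then
        alpha i * (tau (k - i)%N == i :> nat)%:R * u (k - i)%N else 0).
    rewrite -big_mkcond -[RHS]big_mkcond /=.
    pose F i := alpha i * (tau (k - i)%N == i :> nat)%:R * u (k - i)%N.
    have w (a b : nat) : \sum_(i < a | (i < b)%N) F i = \sum_(i < a + b | (i < a)%N && (i < b)%N) F i.
      by rewrite (big_ord_widen_cond (a + b) (fun i => (i < b)%N) F) ?leq_addr //; apply: eq_bigl => i; rewrite andbC.
    rewrite (eq_bigl (fun i : 'I_tb.+1 => (i < k.+1)%N)) //.
    by rewrite (w tb.+1 k.+1) (w k.+1 tb.+1) addnC; apply: eq_bigl => i; rewrite andbC.
  rewrite /e [X in _ = _ + X](reindex_inj rev_ord_inj) /= /convol -big_split; apply: eq_bigr => -[i /= ik] _.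
  have -> : (k.+1 - i.+1 = k - i)%N by lia.
  have -> : (k - (k - i) = i)%N by lia.
  rewrite /coefs /h /Hpoly -(poly_def tb.+1 (fun i => alpha i * p i)) !coef_poly.
  by case: ifP => _; ring.
(* [g] is known through [d * g = n] and the loop through [chi], so both sides are compared after
   convolution with [d * chi], which is cancellable because its constant term is nonzero. *)
have key : u = convol g (fun k => v k + e k).
  apply: (@convol_inj _ (coefs (d * chi))).
    by rewrite /coefs coef0M mulf_neq0 // chi0.
  rewrite -convol_coefs -!convolA.
  have -> : convol (coefs chi) u = convol (coefs (bK * bP)) (fun k => v k + e k).
    have E1 : convol (coefs (aK * aP)) u =
        convol (coefs (bK * bP)) (fun k => (v k + e k) + convol (coefs h) u k).
      rewrite [aK * aP]mulrC -!convol_coefs -!convolA Ku [LHS]convolA [convol (coefs aP) (coefs bK)]convolC -convolA Py.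
      congr (convol _ (convol _ _)); apply/funext => k; rewrite udE'; ring.
    have -> : coefs chi = (fun k => coefs (aK * aP) k - coefs (h * bK * bP) k).
      by apply/funext => k; rewrite /coefs /chi /char_loop coefB.
    rewrite convolC convolBr convolC E1 convolDr [convol u _]convolC.
    apply/funext => k; rewrite -mulrA [h * _]mulrC -[coefs (_ * h)]convol_coefs -convolA.
    by rewrite addrK.
  rewrite [LHS]convolA convol_coefs dn -convol_coefs -dg.
  by rewrite -[LHS]convolA -[convol (convol (coefs d) g) _]convolA [LHS]convolA
    [convol (coefs chi) (coefs d)]convolC -[LHS]convolA.
move=> k; rewrite {1}key convolDr; congr (_ + _).
(* The term of index [k] drops because [g 0 = 0]: the present delay does not act on [u k]. *)
rewrite (convol_triangular g (fun j i => (xi tb alpha p (tau j))`_i * u j) k) big_ord_recr /= subnn [X in _ + X](_ : _ = 0) ?addr0; last first.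
  by rewrite /convol big_ord1 subn0 g0 mulr0.
apply: eq_bigr => m _; rewrite /gain /convol mulr_suml; apply: eq_bigr => i _.
by rewrite /coefs mulrAC.
Qed.

End Loop.

(** * Moments of the loop signals *)

Section Independence.
Context {d} {T : measurableType d} {R : realType} (P : probability T R).

(** Restricted to [W], the law of [phi] is [c] times its full law; equality of these two image
    measures passes from sets to integrals. *)
Lemma ge0_integral_indep {d'} {Y : measurableType d'} (phi : T -> Y)
    (W : set T) (c : R) (f : Y -> \bar R) :
  measurable_fun setT phi -> measurable W -> 0 <= c ->
  (forall E, measurable E -> P (phi @^-1` E `&` W) = (c%:E * P (phi @^-1` E))%E) ->
  measurable_fun setT f -> (forall y, (0 <= f y)%E) ->
  (\int[P]_(w in W) f (phi w) = c%:E * \int[P]_w f (phi w))%E.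
Proof.
move=> mphi mW c0 h mf f0.
have mfphi : measurable_fun setT (f \o phi) by exact: measurableT_comp.
transitivity (\int[mrestr P mW]_(w in W) f (phi w))%E.
  by apply: eq_measure_integral => A mA AW; rewrite /= /mrestr setIidl.
transitivity (\int[mrestr P mW]_w f (phi w))%E.
  rewrite [RHS](@ge0_negligible_integral _ _ _ _ setT (~` W)) //.
  - by rewrite setTD setCK.
  - exact: measurableC.
  - by rewrite /= /mrestr setICl measure0.
rewrite -(@ge0_integral_pushforward _ _ _ _ _ _ mphi (mrestr P mW) setT f) //.
rewrite -(@ge0_integral_pushforward _ _ _ _ _ _ mphi P setT f) //.
pose k : {nonneg R} := NngNum c0.
rewrite -(@ge0_integral_mscale _ _ _ (pushforward P phi) setT measurableT k f) //.
apply: eq_measure_integral => A mA _.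
exact: h.
Qed.

Lemma Rintegral_indep {d'} {Y : measurableType d'} (phi : T -> Y)
    (W : set T) (c : R) (f : Y -> R) :
  measurable_fun setT phi -> measurable W -> 0 <= c ->
  (forall E, measurable E -> P (phi @^-1` E `&` W) = (c%:E * P (phi @^-1` E))%E) ->
  measurable_fun setT f -> P.-integrable setT (EFin \o (f \o phi)) ->
  \int[P]_(w in W) f (phi w) = c * \int[P]_w f (phi w).
Proof.
move=> mphi mW c0 h mf intf; rewrite /Rintegral.
have mfE : measurable_fun setT (EFin \o f) by exact/measurable_EFinP.
have pE (D : set T) : (\int[P]_(w in D) (f (phi w))%:E =
    \int[P]_(w in D) ((EFin \o f)^\+ (phi w)) - \int[P]_(w in D) ((EFin \o f)^\- (phi w)))%E.
  rewrite [LHS]integralE.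
  rewrite -[(fun x => (f (phi x))%:E)]/((EFin \o f) \o phi).
  by rewrite funepos_comp funeneg_comp.
rewrite !pE.
rewrite (ge0_integral_indep mphi mW c0 h); [|exact: measurable_funepos|by move=> y; exact: funepos_ge0].
rewrite (ge0_integral_indep mphi mW c0 h); [|exact: measurable_funeneg|by move=> y; exact: funeneg_ge0].
have fp : (\int[P]_w ((EFin \o f)^\+ (phi w)))%E \is a fin_num.
  have := integrable_pos_fin_num measurableT intf.
  by rewrite -[EFin \o (f \o phi)]/((EFin \o f) \o phi) funepos_comp.
have fn : (\int[P]_w ((EFin \o f)^\- (phi w)))%E \is a fin_num.
  have := integrable_neg_fin_num measurableT intf.
  by rewrite -[EFin \o (f \o phi)]/((EFin \o f) \o phi) funeneg_comp.
rewrite -(fineK fp) -(fineK fn) -!EFinM -!EFinB /=.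
by rewrite mulrBr.
Qed.

(** Rectangles are stable under intersection and generate the product sigma-algebra, so two finite
    measures that agree on them are equal. *)
Lemma indep_pair (X Y : T -> R) (W : set T) (c : R) :
  measurable_fun setT X -> measurable_fun setT Y -> measurable W -> 0 <= c ->
  (forall A B, measurable A -> measurable B ->
    P ((X @^-1` A `&` Y @^-1` B) `&` W) = (c%:E * P (X @^-1` A `&` Y @^-1` B))%E) ->
  forall E : set (R * R), measurable E ->
  P ((fun w => (X w, Y w)) @^-1` E `&` W) = (c%:E * P ((fun w => (X w, Y w)) @^-1` E))%E.
Proof.
move=> mX mY mW c0 h.
have mXY : measurable_fun setT (fun w => (X w, Y w)) by exact: measurable_fun_pair.
pose C : set (set (R * R)) := [set C | exists A, measurable A /\
  exists B, measurable B /\ C = A `*` B].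
have CI : setI_closed C.
  move=> /= _ _ [X1 [mX1 [X2 [mX2 ->]]]] [Y1 [mY1 [Y2 [mY2 ->]]]].
  rewrite -setXI; exists (X1 `&` Y1); split; first exact: measurableI.
  by exists (X2 `&` Y2); split => //; exact: measurableI.
pose k : {nonneg R} := NngNum c0.
pose m1 : {measure set (R * R) -> \bar R} := pushforward (mrestr P mW) (fun w => (X w, Y w)).
pose m2 : {measure set (R * R) -> \bar R} := mscale k (pushforward P (fun w => (X w, Y w))).
move=> E mE.
have : m1 mXY E = m2 mXY E.
  apply: (measure_unique C (fun=> setT)) => //.
  - rewrite measurable_prod_measurableType //; congr (<<s _ >>).
    rewrite predeqE; split => [[A mA [B mB <-]]|[A [mA [B [mB ->]]]]].
      by exists A; split => //; exists B.
    by exists A => //; exists B.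
  - by move=> _; exists setT; split => //; exists setT; split => //; rewrite setXTT.
  - by rewrite bigcup_const.
  - by move=> A [A1 [mA1 [A2 [mA2 ->]]]]; exact: h.
  - move=> _; rewrite /m1 /pushforward /= /mrestr /=.
    by apply: (le_lt_trans (probability_le1 _ _)); rewrite ?ltry // setTI.
by [].
Qed.

End Independence.

Section Decomposition.
Context {d} {T : measurableType d} {R : realType} (P : probability T R).

Lemma integrable_EFinZl (c : R) (f : T -> R) :
  P.-integrable setT (EFin \o f) -> P.-integrable setT (EFin \o (fun w => c * f w)).
Proof.
move=> h; rewrite (_ : _ \o _ = (fun w => c%:E * (EFin \o f) w)%E).
  exact: integrableZl.
by apply/funext => w /=; rewrite EFinM.
Qed.

(** A factor with finitely many values is constant on each fiber; this does the work of conditioning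
    on the delays. *)
Lemma fin_decomp (I : finType) (K : T -> I) (F : I -> R) (Z : T -> R) :
  (forall i, measurable (K @^-1` [set i])) -> P.-integrable setT (EFin \o Z) ->
  P.-integrable setT (EFin \o (fun w => F (K w) * Z w)) /\
  \int[P]_w (F (K w) * Z w) = \sum_i F i * \int[P]_(w in K @^-1` [set i]) Z w.
Proof.
move=> mK iZ.
have iZi i : P.-integrable setT (EFin \o (Z \_ (K @^-1` [set i]))).
  rewrite (_ : _ \o _ = (EFin \o Z) \_ (K @^-1` [set i])); last first.
    by apply/funext => w; rewrite /= /patch; case: ifP.
  apply: (iffLR (integrable_mkcond _ (mK i))).
  exact: (integrableS measurableT (mK i) (@subsetT _ _) iZ).
have -> : (fun w => F (K w) * Z w) = (fun w => \sum_i F i * (Z \_ (K @^-1` [set i])) w).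
  apply/funext => w; rewrite (bigD1 (K w)) //= big1 ?addr0 => [|i iK].
    by rewrite /patch mem_set.
  rewrite /patch memNset ?mulr0 //= => Ki.
  by rewrite Ki eqxx in iK.
split; first by apply: integrable_bigsum => // i; exact: integrable_EFinZl.
rewrite Rintegral_bigsum //; last by move=> i; exact: integrable_EFinZl.
apply: eq_bigr => i _; rewrite RintegralZl //.
by rewrite [in RHS]Rintegral_mkcond.
Qed.

End Decomposition.

(** * Delay words and finite combinations of the inputs *)

Section Process.
Context {R : realType} {tb : nat} {p : nat -> R} {d} {T : measurableType d}.
Context {P : probability T R} {tau : nat -> T -> 'I_tb.+1} {v : nat -> T -> R}.
Hypothesis p_ge0 : forall i, (i <= tb)%N -> 0 <= p i.
Hypothesis sum_p : \sum_(s < tb.+1) p s = 1.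
Hypotheses (tauI : tau_iid P tau p) (vI : v_iid P v).
Hypotheses (v2 : finite_variance P v) (vtau : indep_v_tau P v tau).

Local Notation A := 'I_tb.+1.

Definition cyl (s : seq A) : set T :=
  [set w | forall j : 'I_(size s), tau j w = nth ord0 s j].

Definition wt (s : seq A) : R := \prod_(t <- s) p t.

Lemma wt_ge0 s : 0 <= wt s.
Proof. by apply: prodr_ge0 => t _; apply: p_ge0; rewrite -ltnS. Qed.

Lemma wt_rcons s t : wt (rcons s t) = wt s * p t.
Proof. by rewrite /wt -cats1 big_cat big_seq1. Qed.

Lemma cyl_rcons s t : cyl (rcons s t) = cyl s `&` tau (size s) @^-1` [set t].
Proof.
apply/seteqP; split => w /=.
  move=> h; split => [[j /= js]|].
    have jr : (j < size (rcons s t))%N by rewrite size_rcons ltnS ltnW.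
    by have := h (Ordinal jr); rewrite /= nth_rcons js.
  have jr : (size s < size (rcons s t))%N by rewrite size_rcons.
  by have := h (Ordinal jr); rewrite /= nth_rcons ltnn eqxx.
move=> [h1 h2] [j /=]; rewrite size_rcons ltnS leq_eqVlt nth_rcons => /orP[/eqP ->|js].
  by rewrite ltnn eqxx.
by rewrite js; exact: (h1 (Ordinal js)).
Qed.

Lemma measurable_tau k t : measurable (tau k @^-1` [set t]).
Proof. exact: tauI.1. Qed.

Lemma measurable_cyl s : measurable (cyl s).
Proof.
elim/last_ind: s => [|s t IH].
  by rewrite (_ : cyl [::] = setT) //; apply/seteqP; split => // w _ [].
by rewrite cyl_rcons; apply: measurableI => //; exact: measurable_tau.
Qed.

Lemma prob_cyl s : P (cyl s) = (wt s)%:E.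
Proof.
rewrite /cyl (tauI.2 (size s) (fun j => nth ord0 s j)).
by rewrite /wt (big_nth ord0) big_mkord.
Qed.

Lemma cyl_split s V : measurable V ->
  P (V `&` cyl s) = (\sum_(t : A) P (V `&` cyl (rcons s t)))%E.
Proof.
move=> mV.
have mF t : measurable (V `&` cyl (rcons s t)) by apply: measurableI => //; exact: measurable_cyl.
have -> : V `&` cyl s = \big[setU/set0]_(t < tb.+1) (V `&` cyl (rcons s t)).
  apply/seteqP; split => [w [Vw sw]|].
    rewrite (bigD1 (tau (size s) w)) //=; left; split => //.
    by rewrite cyl_rcons; split.
  apply: (big_ind (fun S => S `<=` V `&` cyl s)) => //.
    by move=> S1 S2 h1 h2 w [/h1|/h2].
  by move=> t _ w [Vw]; rewrite cyl_rcons => -[].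
apply: measure_bigsetU_ord => // t1 t2 _ _ [w [[_]]].
rewrite cyl_rcons => -[_ h1] [_]; rewrite cyl_rcons => -[_ h2].
by rewrite -h1 -h2.
Qed.

Lemma measurable_cylv (B : nat -> set R) N : (forall j, measurable (B j)) ->
  measurable [set w | forall j : 'I_N, B j (v j w)].
Proof.
move=> mB; rewrite (_ : [set w | _] = \big[setI/setT]_(j < N) (v j @^-1` B j)).
  apply: bigsetI_measurable => j _; rewrite -[_ @^-1` _]setTI.
  exact: vI.1.
apply/seteqP; split => w /=.
  by move=> h; elim/big_rec: _ => // j S _ Sw; split => //; exact: h.
by move=> + j; rewrite (bigD1 j) //= => -[].
Qed.

(* [indep_v_tau] involves equally many inputs and delays; a shorter word of
   delays is split into its extensions. *)
Lemma indep_cyl (B : nat -> set R) k : (forall j, measurable (B j)) -> forall s,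
  P ([set w | forall j : 'I_(size s + k), B j (v j w)] `&` cyl s) =
  (P [set w | forall j : 'I_(size s + k), B j (v j w)] * (wt s)%:E)%E.
Proof.
move=> mB; elim: k => [|k IH] s.
  rewrite addn0 -prob_cyl.
  exact: (vtau (B := fun j : 'I_(size s) => B j) (fun j => nth ord0 s j) (fun j => mB j)).
rewrite cyl_split; last exact: measurable_cylv.
under eq_bigr => t _.
  have := IH (rcons s t); rewrite size_rcons addSnnS => ->.
  over.
rewrite /= -ge0_sume_distrr; last by move=> t _; rewrite lee_fin wt_ge0.
congr (_ * _)%E; rewrite sumEFin; congr (_%:E).
under eq_bigr do rewrite wt_rcons.
by rewrite -mulr_sumr sum_p mulr1.
Qed.

Lemma measurable_v k : measurable_fun setT (v k).
Proof. exact: vI.1. Qed.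

Lemma indep_pair_cyl i j s A1 A2 : measurable A1 -> measurable A2 ->
  P ((v i @^-1` A1 `&` v j @^-1` A2) `&` cyl s) =
  ((wt s)%:E * P (v i @^-1` A1 `&` v j @^-1` A2))%E.
Proof.
move=> mA1 mA2.
(* For [i = j] both constraints bear on the same input, hence the intersection. *)
pose B l := (if l == i then A1 else setT) `&` (if l == j then A2 else setT).
have mB l : measurable (B l).
  by apply: measurableI; case: ifP => _ //; exact: measurableT.
have := indep_cyl (i + j).+1 mB s.
rewrite muleC (_ : [set w | _] = v i @^-1` A1 `&` v j @^-1` A2) //.
apply/seteqP; split => w /=.
  move=> h; split.
    have il : (i < size s + (i + j).+1)%N by lia.
    by have := h (Ordinal il); rewrite /B /= eqxx => -[].
  have jl : (j < size s + (i + j).+1)%N by lia.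
  by have := h (Ordinal jl); rewrite /B /= eqxx => -[].
move=> [h1 h2] [l /= _]; rewrite /B; split.
  by case: eqP => [->|].
by case: eqP => [->|].
Qed.

Lemma same_law k B : measurable B -> P (v k @^-1` B) = P (v 0%N @^-1` B).
Proof.
move=> mB; pose Bs (j : 'I_k.+1) := if (j : nat) == k then B else setT.
have mBs j : measurable (Bs j) by rewrite /Bs; case: ifP => _ //; exact: measurableT.
have := vI.2 _ _ mBs.
rewrite (_ : [set w | _] = v k @^-1` B); last first.
  apply/seteqP; split => w /=.
    by move=> /(_ ord_max); rewrite /Bs /= eqxx.
  by move=> h j; rewrite /Bs; case: eqP => // ->.
rewrite (bigD1 ord_max) //= {1}/Bs /= eqxx big1 ?mulr1 => [->|j jk].
  rewrite fineK //; apply: fin_num_measure.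
  by rewrite -[_ @^-1` _]setTI; exact: vI.1.
rewrite /Bs ifF ?preimage_setT ?probability_setT //.
by apply: contraNF jk => /eqP jk; apply/eqP; exact: val_inj.
Qed.

Lemma integral_v_sqr k : (\int[P]_w (v k w ^+ 2)%:E = \int[P]_w (v 0%N w ^+ 2)%:E)%E.
Proof.
have mf : measurable_fun setT (fun x : R => (x ^+ 2)%:E).
  by apply/measurable_EFinP; exact: exprn_measurable.
rewrite -(@ge0_integral_pushforward _ _ _ _ _ _ (measurable_v k) P setT (fun x => (x ^+ 2)%:E)) //;
  last by move=> y _; rewrite lee_fin sqr_ge0.
rewrite -(@ge0_integral_pushforward _ _ _ _ _ _ (measurable_v 0) P setT (fun x => (x ^+ 2)%:E)) //;
  last by move=> y _; rewrite lee_fin sqr_ge0.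
by apply: eq_measure_integral; [exact: measurable_v|exact: measurable_v|move=> m0 mk B mB _; exact: same_law].
Qed.

Lemma integrable_v_sqr k : P.-integrable setT (EFin \o (fun w => v k w ^+ 2)).
Proof.
apply/integrableP; split.
  by apply/measurable_EFinP; apply: measurable_funX; exact: measurable_v.
under eq_integral do rewrite gee0_abs ?lee_fin ?sqr_ge0 //.
by rewrite integral_v_sqr; move: v2; rewrite /finite_variance unlock.
Qed.

Lemma integrable_v2 i j : P.-integrable setT (EFin \o (fun w => v i w * v j w)).
Proof.
have h := integrableD measurableT (integrable_v_sqr i) (integrable_v_sqr j).
apply: le_integrable h => //.
  by apply/measurable_EFinP; apply: measurable_funM; exact: measurable_v.
move=> w _ /=; rewrite lee_fin [leRHS]ger0_norm ?addr_ge0 ?sqr_ge0 // ler_norml.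
have := sqr_ge0 (v i w - v j w); have := sqr_ge0 (v i w + v j w).
have := sqr_ge0 (v i w); have := sqr_ge0 (v j w).
by rewrite sqrrD sqrrB => h1 h2 h3 h4; apply/andP; split; lra.
Qed.

Lemma integrable_v1 i : P.-integrable setT (EFin \o v i).
Proof.
have h := integrableD measurableT (integrable_v_sqr i)
  (finite_measure_integrable_cst P 1 measurableT).
apply: le_integrable h => //; first by apply/measurable_EFinP; exact: measurable_v.
move=> w _ /=; rewrite lee_fin [leRHS]ger0_norm ?addr_ge0 ?sqr_ge0 // ler_norml.
have := sqr_ge0 (v i w - 1); have := sqr_ge0 (v i w + 1).
by rewrite sqrrD sqrrB => h1 h2; apply/andP; split; nra.
Qed.

Lemma cond_integral (f : R * R -> R) i j s :
  measurable_fun setT f -> P.-integrable setT (EFin \o (fun w => f (v i w, v j w))) ->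
  \int[P]_(w in cyl s) f (v i w, v j w) = wt s * \int[P]_w f (v i w, v j w).
Proof.
move=> mf intf.
apply: (@Rintegral_indep _ _ _ P _ _ (fun w => (v i w, v j w)) (cyl s) (wt s) f) => //.
- by apply: measurable_fun_pair; exact: measurable_v.
- exact: measurable_cyl.
- exact: wt_ge0.
- apply: indep_pair; [exact: measurable_v|exact: measurable_v|exact: measurable_cyl|exact: wt_ge0|].
  by move=> *; exact: indep_pair_cyl.
Qed.

Definition word n (w : T) : seq A := mkseq (tau^~ w) n.

Lemma word_rcons n w : word n.+1 w = rcons (word n w) (tau n w).
Proof. by rewrite /word /mkseq -[in LHS](addn1 n) iotaD map_cat cats1. Qed.

Lemma size_word n w : size (word n w) = n.
Proof. exact: size_mkseq. Qed.

(** The word as an element of a finite type, as [fin_decomp] requires. *)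
Let wordt n w : n.-tuple A := [tuple tau j w | j < n].

Let wordtE n w : wordt n w = word n w :> seq A.
Proof.
apply: (@eq_from_nth _ ord0); rewrite size_tuple ?size_word // => j jn.
by rewrite nth_mkseq // -[j]/(val (Ordinal jn)) -tnth_nth tnth_mktuple.
Qed.

Lemma cylE n (c : n.-tuple A) : wordt n @^-1` [set c] = cyl c.
Proof.
apply/seteqP; split => w /=.
  move=> wc [j /= jn]; rewrite -wc wordtE nth_mkseq //.
  by move: jn; rewrite size_tuple.
move=> h; apply: val_inj; rewrite /= wordtE; apply: (@eq_from_nth _ ord0).
  by rewrite size_word size_tuple.
move=> j; rewrite size_word => jn; rewrite nth_mkseq //.
have jc : (j < size c)%N by rewrite size_tuple.
exact: (h (Ordinal jc)).
Qed.

(** Both expectations are split along delay words; the weight of [rcons c t] is that of [c] times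
    [p t], so the delay at time [n] factors out. *)
Lemma word_factor (f : R * R -> R) i j n (phi : seq A -> R) (psi : A -> R) :
  measurable_fun setT f -> P.-integrable setT (EFin \o (fun w => f (v i w, v j w))) ->
  [/\ P.-integrable setT (EFin \o (fun w => phi (word n w) * f (v i w, v j w))),
      P.-integrable setT (EFin \o (fun w => psi (tau n w) * (phi (word n w) * f (v i w, v j w)))) &
      \int[P]_w (psi (tau n w) * (phi (word n w) * f (v i w, v j w))) =
      (\sum_(t < tb.+1) p t * psi t) * \int[P]_w (phi (word n w) * f (v i w, v j w))].
Proof.
move=> mf iZ; set Z := fun w => f (v i w, v j w).
pose K w := (wordt n w, tau n w).
have KE c t : K @^-1` [set (c, t)] = cyl (rcons c t).
  rewrite cyl_rcons -cylE size_tuple; apply/seteqP; split => w /=.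
    by rewrite /K => -[-> ->].
  by rewrite /K => -[-> ->].
have [|i1 E1] := @fin_decomp _ _ _ P _ (wordt n) (fun c => phi c) Z _ iZ.
  by move=> c; rewrite cylE; exact: measurable_cyl.
have [|i2 E2] := @fin_decomp _ _ _ P _ K (fun ct => psi ct.2 * phi ct.1) Z _ iZ.
  by move=> -[c t]; rewrite KE; exact: measurable_cyl.
have F1 : (fun w => phi (word n w) * Z w) = (fun w => phi (wordt n w) * Z w).
  by apply/funext => w; rewrite wordtE.
have F2 : (fun w => psi (tau n w) * (phi (word n w) * Z w)) =
          (fun w => psi (K w).2 * phi (K w).1 * Z w).
  by apply/funext => w; rewrite /= wordtE mulrA.
rewrite F1 F2 E1 E2; split => //.
rewrite (eq_bigr (fun ct : n.-tuple A * A => psi ct.2 * phi ct.1 * \int[P]_(w in K @^-1` [set (ct.1, ct.2)]) Z w)); last by case.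
rewrite -(pair_bigA _ (fun (c : n.-tuple A) (t : A) => psi t * phi c * \int[P]_(w in K @^-1` [set (c, t)]) Z w)) /=.
rewrite mulr_sumr; apply: eq_bigr => c _; rewrite mulr_suml; apply: eq_bigr => t _.
rewrite KE cylE !cond_integral // wt_rcons.
by ring.
Qed.

(* Such an [X] is square integrable, and the delays from time [n] on are
   independent of it. *)
Definition lin n (X : T -> R) := exists N (a : nat -> seq A -> R),
  X = fun w => \sum_(m < N) a m (word n w) * v m w.

Lemma linZ n c X : lin n X -> lin n (fun w => c * X w).
Proof.
move=> [N [a ->]]; exists N, (fun m s => c * a m s); apply/funext => w.
by rewrite mulr_sumr; apply: eq_bigr => m _; rewrite mulrA.
Qed.

Lemma linD n X Y : lin n X -> lin n Y -> lin n (fun w => X w + Y w).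
Proof.
move=> [N [a ->]] [M [b ->]].
exists (N + M)%N, (fun m s => (m < N)%N%:R * a m s + (m < M)%N%:R * b m s).
apply/funext => w; under [RHS]eq_bigr do rewrite mulrDl.
have h k l (F : nat -> R) : (k <= l)%N -> \sum_(m < k) F m = \sum_(m < l) (m < k)%N%:R * F m.
  move=> kl; rewrite (big_ord_widen _ F kl) big_mkcond /=; apply: eq_bigr => m _.
  by case: ifP => _; rewrite ?mul1r ?mul0r.
rewrite big_split (h N (N + M)%N (fun m => a m (word n w) * v m w)) ?leq_addr //.
rewrite (h M (N + M)%N (fun m => b m (word n w) * v m w)) ?leq_addl //.
by congr (_ + _); apply: eq_bigr => m _; rewrite mulrA.
Qed.

Lemma lin_v n m : lin n (v m).
Proof.
exists m.+1, (fun k _ => (k == m)%:R); apply/funext => w.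
rewrite big_ord_recr /= eqxx mul1r big1 ?add0r // => i _.
by rewrite (ltn_eqF (ltn_ord i)) mul0r.
Qed.

Lemma lin0 n : lin n (fun=> 0).
Proof. by exists 0%N, (fun _ _ => 0); apply/funext => w; rewrite big_ord0. Qed.

Lemma lin_sum n (I : finType) (X : I -> T -> R) : (forall i, lin n (X i)) ->
  lin n (fun w => \sum_i X i w).
Proof.
move=> h; rewrite (_ : (fun w => _) = \sum_i X i); last first.
  by apply/funext => w; rewrite fct_sumE.
elim/big_rec: _ => [|i Y _ IH]; first exact: lin0.
exact: (linD (h i) IH).
Qed.

Lemma lin_step n (psi : A -> R) X : lin n X -> lin n.+1 (fun w => psi (tau n w) * X w).
Proof.
move=> [N [a ->]]; exists N, (fun m s => psi (nth ord0 s n) * a m (take n s)).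
apply/funext => w; rewrite mulr_sumr; apply: eq_bigr => m _.
rewrite word_rcons nth_rcons size_word ltnn eqxx mulrA; congr (_ * _ * _).
by rewrite -cats1 take_size_cat ?size_word.
Qed.

Lemma lin_leq n m X : (n <= m)%N -> lin n X -> lin m X.
Proof.
move=> nm hX; elim: m nm => [|m IH]; first by rewrite leqn0 => /eqP <-.
rewrite leq_eqVlt => /predU1P[<- //|]; rewrite ltnS => /IH h.
have -> : X = (fun w => 1 * X w) by apply/funext => w; rewrite mul1r.
exact: (lin_step (fun=> 1) h).
Qed.

Lemma lin_mul n X Y (psi : A -> R) : lin n X -> lin n Y ->
  [/\ P.-integrable setT (EFin \o (fun w => X w * Y w)),
      P.-integrable setT (EFin \o (fun w => psi (tau n w) * (X w * Y w))) &
      \int[P]_w (psi (tau n w) * (X w * Y w)) =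
      (\sum_(t < tb.+1) p t * psi t) * \int[P]_w (X w * Y w)].
Proof.
move=> [N [a ->]] [M [b ->]].
have mf : measurable_fun setT (fun x : R * R => x.1 * x.2).
  by apply: measurable_funM; [exact: measurable_fst|exact: measurable_snd].
have h i j := @word_factor _ i j n (fun s => a i s * b j s) psi mf (integrable_v2 i j).
pose Z (i : 'I_N * 'I_M) w := a i.1 (word n w) * b i.2 (word n w) * (v i.1 w * v i.2 w).
have E1 : (fun w => (\sum_(m < N) a m (word n w) * v m w) * (\sum_(m < M) b m (word n w) * v m w)) =
          (fun w => \sum_i Z i w).
  apply/funext => w; rewrite big_distrlr /= pair_big; apply: eq_bigr => i _.
  by rewrite /Z mulrACA.
have E2 : (fun w => psi (tau n w) * ((\sum_(m < N) a m (word n w) * v m w) * (\sum_(m < M) b m (word n w) * v m w))) =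
          (fun w => \sum_i psi (tau n w) * Z i w).
  by apply/funext => w; rewrite (congr1 (@^~ w) E1) mulr_sumr.
rewrite E1 E2; split.
- by apply: integrable_bigsum => // -[i j]; have [] := h i j.
- by apply: integrable_bigsum => // -[i j]; have [] := h i j.
rewrite !Rintegral_bigsum //; last first.
- by move=> -[i j]; have [] := h i j.
- by move=> -[i j]; have [] := h i j.
by rewrite mulr_sumr; apply: eq_bigr => -[i j] _; have [] := h i j.
Qed.

Lemma lin_mean n X (psi : A -> R) : lin n X ->
  [/\ P.-integrable setT (EFin \o X),
      P.-integrable setT (EFin \o (fun w => psi (tau n w) * X w)) &
      \int[P]_w (psi (tau n w) * X w) =
      (\sum_(t < tb.+1) p t * psi t) * \int[P]_w X w].
Proof.
move=> [N [a ->]].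
have mf : measurable_fun setT (fun x : R * R => x.1) by exact: measurable_fst.
have h i := @word_factor _ i i n (fun s => a i s) psi mf (integrable_v1 i).
have E2 : (fun w => psi (tau n w) * (\sum_(m < N) a m (word n w) * v m w)) =
          (fun w => \sum_(m < N) psi (tau n w) * (a m (word n w) * v m w)).
  by apply/funext => w; rewrite mulr_sumr.
rewrite E2; split.
- by apply: integrable_bigsum => // i; have [] := h i.
- by apply: integrable_bigsum => // i; have [] := h i.
rewrite !Rintegral_bigsum //; last first.
- by move=> i; have [] := h i.
- by move=> i; have [] := h i.
by rewrite mulr_sumr; apply: eq_bigr => i _; have [] := h i.
Qed.

(** * Moment recursions for the loop *)

Section Moments.
Variables (alpha g : nat -> R) (u : nat -> T -> R).
Local Notation G := (gain tb alpha p g).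
Let x k w := convol g (fun m => v m w) k.
Hypothesis uE : forall k w, u k w = x k w + \sum_(m < k) G (k - m) (tau m w) * u m w.

Lemma gain_mean j : \sum_(s < tb.+1) p s * G j s = 0.
Proof.
rewrite /gain /convol; under eq_bigr do rewrite mulr_sumr.
rewrite exchange_big big1 // => i _ /=.
under eq_bigr do rewrite mulrA.
rewrite -mulr_suml /coefs; case: (ltnP i tb.+1) => [ib|ib]; last first.
  by rewrite big1 ?mul0r // => s _; rewrite coef_poly ltnNge ib /= mulr0.
rewrite (_ : \sum_(_ < _) _ = 0) ?mul0r //.
transitivity (\sum_(s < tb.+1) (alpha i * (p s * ((s : nat) == i)%:R) - alpha i * p i * p s)).
  by apply: eq_bigr => s _; rewrite coef_poly ib; ring.
rewrite sumrB -!mulr_sumr sum_p mulr1 (bigD1 (Ordinal ib)) //= eqxx mulr1 big1 ?addr0 ?subrr //.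
by move=> s si; rewrite -[_ == i :> nat]/(s == Ordinal ib) (negbTE si) mulr0.
Qed.

Lemma lin_x n k : lin n (x k).
Proof. by apply: lin_sum => i; apply: linZ; exact: lin_v. Qed.

Lemma lin_partial k m : (forall j, (j < m)%N -> lin j (u j)) ->
  lin m (fun w => x k w + \sum_(j < m) G (k - j) (tau j w) * u j w).
Proof.
move=> h; apply: linD; first exact: lin_x.
apply: lin_sum => -[j /= jm]; apply: (lin_leq jm).
exact: (lin_step (fun t : A => G (k - j) t) (h j jm)).
Qed.

Lemma lin_u k : lin k (u k).
Proof.
elim/ltn_ind: k => k IH.
rewrite (_ : u k = (fun w => x k w + \sum_(j < k) G (k - j) (tau j w) * u j w)).
  exact: lin_partial.
by apply/funext => w; exact: uE.
Qed.

Lemma second_moment k : \int[P]_w (u k w * u k w) =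
  \int[P]_w (x k w * x k w) + \sum_(m < k) fvar tb alpha p g (k - m) * \int[P]_w (u m w * u m w).
Proof.
(* [S m] collects the contributions to [u k] of the delays before [m]. Adding the one of time [m]
   leaves a cross term, which vanishes since the gain has mean zero and [tau m] is independent of
   [S m] and [u m], and a square, which yields the new summand. *)
pose S m w := x k w + \sum_(j < m) G (k - j) (tau j w) * u j w.
have linS m : lin m (S m) by apply: lin_partial => j _; exact: lin_u.
have main m : \int[P]_w (S m w * S m w) = \int[P]_w (x k w * x k w) +
    \sum_(j < m) fvar tb alpha p g (k - j) * \int[P]_w (u j w * u j w).
  elim: m => [|m IH].
    rewrite big_ord0 addr0; congr (Rintegral _ _ _); apply/funext => w.
    by rewrite /S big_ord0 addr0.
  rewrite big_ord_recr /= addrA -IH.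
  have [i1 _ _] := lin_mul (fun=> 0) (linS m) (linS m).
  have [_ i2 E2] := lin_mul (fun t : A => 2 * G (k - m) t) (linS m) (lin_u m).
  have [_ i3 E3] := lin_mul (fun t : A => G (k - m) t ^+ 2) (lin_u m) (lin_u m).
  have -> : (fun w => S m.+1 w * S m.+1 w) = (fun w => S m w * S m w +
      (2 * G (k - m) (tau m w) * (S m w * u m w) +
       G (k - m) (tau m w) ^+ 2 * (u m w * u m w))).
    by apply/funext => w; rewrite /S big_ord_recr /=; ring.
  have i23 := integrableD measurableT i2 i3.
  rewrite RintegralD // RintegralD // E2 E3.
  rewrite (_ : \sum_(t < tb.+1) p t * (2 * G (k - m) t) = 0).
    by rewrite mul0r add0r.
  under eq_bigr do rewrite mulrCA.
  by rewrite -mulr_sumr gain_mean mulr0.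
rewrite -main; congr (Rintegral _ _ _); apply/funext => w.
by rewrite /S -uE.
Qed.

Lemma first_moment k : \int[P]_w u k w = \int[P]_w x k w.
Proof.
have -> : u k = (fun w => x k w + \sum_(j < k) G (k - j) (tau j w) * u j w).
  by apply/funext => w; exact: uE.
have [ix _ _] := lin_mean (fun=> 0) (lin_x 0 k).
have h (j : 'I_k) := lin_mean (fun t : A => G (k - j) t) (lin_u j).
have iS : P.-integrable setT (EFin \o (fun w => \sum_(j < k) G (k - j) (tau j w) * u j w)).
  by apply: integrable_bigsum => // j; have [] := h j.
rewrite (RintegralD measurableT ix iS).
rewrite (@Rintegral_bigsum _ _ _ P setT _ (fun (j : 'I_k) w => G (k - j) (tau j w) * u j w)) //;
  last by move=> j; have [] := h j.
rewrite [X in _ + X]big1 ?addr0 // => j _.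
by have [_ _ ->] := h j; rewrite gain_mean mul0r.
Qed.

Lemma variance_lin n X : lin n X ->
  'V_P[X] = (\int[P]_w (X w * X w) - (\int[P]_w X w) ^+ 2)%:E.
Proof.
move=> hX; have [i2 _ _] := lin_mul (fun=> 0) hX hX; have [i1 _ _] := lin_mean (fun=> 0) hX.
rewrite /variance covariance.unlock !expectation.unlock.
rewrite -/(Rintegral P setT X); set mu := Rintegral P setT X.
have i1' := integrable_EFinZl (- (2 * mu)) i1.
have ic := finite_measure_integrable_cst P (mu ^+ 2) measurableT.
have i12 := integrableD measurableT i1' ic.
have E w : ((X \- cst mu) * (X \- cst mu)) w = X w * X w + (- (2 * mu) * X w + cst (mu ^+ 2) w).
  by rewrite -[LHS]/((X w - mu) * (X w - mu)) /=; ring.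
under eq_integral do rewrite E.
have i := integrableD measurableT i2 i12.
rewrite -[LHS]fineK; last by apply: integrable_fin_num => //.
congr (_%:E); rewrite -/(Rintegral P setT (fun w => X w * X w + (- (2 * mu) * X w + cst (mu ^+ 2) w))).
rewrite RintegralD // RintegralD // RintegralZl // (Rintegral_cst P measurableT).
have -> : fine (P setT) = 1 by rewrite probability_setT.
by rewrite -/mu; ring.
Qed.

(** The inputs need not be centred, so mixed moments are bounded through [|a b| <= (a^2 + b^2) / 2]
    and the common law. *)
Lemma abs_second_moment_v i j :
  `|\int[P]_w (v i w * v j w)| <= \int[P]_w (v 0%N w ^+ 2).
Proof.
have s k : \int[P]_w (v k w ^+ 2) = \int[P]_w (v 0%N w ^+ 2).
  by rewrite /Rintegral integral_v_sqr.
have i2 := integrable_v2 i j.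
apply: (le_trans (le_normr_Rintegral _ i2)) => //.
have ia k := integrable_EFinZl 2^-1 (integrable_v_sqr k).
have iD := integrableD measurableT (ia i) (ia j).
apply: (@le_trans _ _ (\int[P]_w (2^-1 * v i w ^+ 2 + 2^-1 * v j w ^+ 2))).
  apply: le_Rintegral => //.
    by have := integrable_norm i2.
  move=> w _ /=; rewrite ler_norml.
  have := sqr_ge0 (v i w - v j w); have := sqr_ge0 (v i w + v j w).
  by rewrite sqrrD sqrrB => h1 h2; apply/andP; split; lra.
rewrite RintegralD // !RintegralZl // ?s //; try exact: integrable_v_sqr.
by lra.
Qed.

Lemma second_moment_x k : \int[P]_w (x k w * x k w) =
  \sum_(i < k.+1) \sum_(j < k.+1) g i * g j * \int[P]_w (v (k - i)%N w * v (k - j)%N w).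
Proof.
have -> : (fun w => x k w * x k w) = (fun w => \sum_(i < k.+1) \sum_(j < k.+1)
    g i * g j * (v (k - i)%N w * v (k - j)%N w)).
  apply/funext => w; rewrite /x /convol big_distrlr /=; apply: eq_bigr => i _.
  by apply: eq_bigr => j _; rewrite mulrACA.
have h i j := integrable_EFinZl (g i * g j) (integrable_v2 (k - i) (k - j)).
rewrite Rintegral_bigsum // => [|i]; last by apply: integrable_bigsum => // j; exact: h.
apply: eq_bigr => i _; rewrite Rintegral_bigsum //.
by apply: eq_bigr => j _; rewrite RintegralZl //; exact: integrable_v2.
Qed.

Lemma second_moment_x_bound B : (forall N, \sum_(k < N) `|g k| <= B) ->
  forall k, \int[P]_w (x k w * x k w) <= B ^+ 2 * \int[P]_w (v 0%N w ^+ 2).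
Proof.
move=> hB k; rewrite second_moment_x.
have s0 : 0 <= \int[P]_w (v 0%N w ^+ 2) by apply: Rintegral_ge0 => w _; exact: sqr_ge0.
apply: (@le_trans _ _ ((\sum_(i < k.+1) `|g i|) ^+ 2 * \int[P]_w (v 0%N w ^+ 2))).
  rewrite expr2 big_distrlr mulr_suml; apply: ler_sum => i _ /=.
  rewrite mulr_suml; apply: ler_sum => j _; apply: (le_trans (ler_norm _)).
  by rewrite !normrM ler_wpM2l ?mulr_ge0 // abs_second_moment_v.
have B0 : 0 <= B by have := hB 0%N; rewrite big_ord0.
rewrite ler_wpM2r //; apply: lerXn2r; rewrite ?nnegrE //.
by apply: sumr_ge0 => i _.
Qed.

End Moments.

End Process.

(** * Independent delays and Rademacher inputs on the unit interval *)

Section UnitLebesgue.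
Variable R : realType.

Definition unit_leb : set (measurableTypeR R) -> \bar R :=
  mrestr (@lebesgue_measure R) (measurable_itv `[0, 1[%R).

HB.instance Definition _ := Measure.on unit_leb.

Lemma unit_leb_setT : unit_leb setT = 1%E.
Proof. by rewrite /unit_leb /mrestr setTI lebesgue_measure_itv /= lte_fin ltr01 oppr0 adde0. Qed.

HB.instance Definition _ := Measure_isProbability.Build _ _ _ unit_leb unit_leb_setT.

(** * Coding the unit interval by a weighted alphabet *)

Section Coding.
Variables (B : finType) (q : B -> R) (b0 : B).
Hypotheses (q_ge0 : forall b, 0 <= q b) (sum_q : \sum_b q b = 1).

(** Cumulative weights: they cut the unit interval into consecutive pieces, the one of letter [b]
    starting at [L b] with length [q b]. *)
Let C (k : nat) : R := \sum_(i < k) q (nth b0 (enum B) i).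
Let L b := C (index b (enum B)).

Let C_le k l : (k <= l)%N -> C k <= C l.
Proof.
by move=> /subnKC <-; rewrite /C big_split_ord /= lerDl sumr_ge0.
Qed.

Let C_index b : C (index b (enum B)).+1 = L b + q b.
Proof. by rewrite /L {1}/C big_ord_recr /= nth_index ?mem_enum. Qed.

Let C_full : C (size (enum B)) = 1.
Proof.
by rewrite -sum_q -big_enum /= (big_nth b0) big_mkord.
Qed.

Definition symbol (x : R) : B := xget b0 [set b | L b <= x < L b + q b].
(** The affine map that stretches the piece containing [x] onto the unit interval; for equal weights
    it is the digit shift of a positional expansion. *)
Definition shift (x : R) : R := (x - L (symbol x)) / q (symbol x).

Let cover x : 0 <= x < 1 -> exists b, L b <= x < L b + q b.
Proof.
move=> /andP[x0 x1].
have ex : exists k, x < C k by exists (size (enum B)); rewrite C_full.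
case: (ex_minnP ex) => -[|k] xk kmin.
  by move: xk; rewrite /C big_ord0 ltNge x0.
have ks : (k < size (enum B))%N.
  by apply: kmin; rewrite C_full.
exists (nth b0 (enum B) k).
rewrite -C_index /L index_uniq ?enum_uniq // xk andbT leNgt; apply/negP => /kmin.
by rewrite ltnn.
Qed.

Let disj b b' x : L b <= x < L b + q b -> L b' <= x < L b' + q b' -> b = b'.
Proof.
have aux c c' : L c <= x < L c + q c -> L c' <= x < L c' + q c' ->
    ~ (index c (enum B) < index c' (enum B))%N.
  move=> /andP[_ h1] /andP[h2 _] /C_le; rewrite C_index -/(L c') => h3.
  by have := lt_le_trans h1 (le_trans h3 h2); rewrite ltxx.
move=> h1 h2; have /negP := aux _ _ h1 h2; have /negP := aux _ _ h2 h1.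
rewrite -!leqNgt => i1 i2.
have /eqP ii : index b (enum B) == index b' (enum B) by rewrite eqn_leq i1 i2.
by rewrite -[b](@nth_index _ b0 _ (enum B)) ?mem_enum // ii nth_index ?mem_enum.
Qed.

Lemma symbolP x b : 0 <= x < 1 -> symbol x = b <-> L b <= x < L b + q b.
Proof.
move=> /cover[b1 h1]; rewrite /symbol; split => [<-|h].
  by case: xgetP => [b2 -> //|/(_ b1)].
by case: xgetP => [b2 _ /disj|/(_ b)] h2; [exact: h2|].
Qed.

Definition letter (k : nat) (x : measurableTypeR R) : B := symbol (iter k shift x).

(* Expanding interval maps: the points coded by a word form an interval whose
   length is the product of the weights of its letters. *)
Lemma letter_word (c : seq B) : exists a, [/\ 0 <= a, a + \prod_(b <- c) q b <= 1 &
  forall x, 0 <= x < 1 ->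
    (forall j, (j < size c)%N -> letter j x = nth b0 c j) <-> a <= x < a + \prod_(b <- c) q b].
Proof.
elim: c => [|b c [a [a0 a1 IH]]].
  by exists 0; rewrite big_nil add0r; split.
set w := \prod_(b <- c) q b in a1 IH.
have w0 : 0 <= w by apply: prodr_ge0.
(* The interval of [c] is pulled back along the branch of [shift] on the piece of [b], which
   contracts it by [q b]. *)
exists (L b + q b * a); rewrite big_cons -/w -addrA -mulrDr.
have L0 : 0 <= L b by apply: sumr_ge0 => i _; exact: q_ge0.
have L1 : L b + q b <= 1.
  by rewrite -C_index -C_full; apply: C_le; rewrite index_mem mem_enum.
split.
- by rewrite addr_ge0 // mulr_ge0.
- by apply: le_trans L1; rewrite lerD2l -[leRHS]mulr1 ler_wpM2l.
move=> x x01.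
have split1 : (forall j, (j < size (b :: c))%N -> letter j x = nth b0 (b :: c) j) <->
    symbol x = b /\ (forall j, (j < size c)%N -> letter j (shift x) = nth b0 c j).
  split => [h|[h1 h2] [|j] //= js].
    split; first exact: (h 0%N).
    by move=> j js; have := h j.+1 js; rewrite /letter iterSr.
  by have := h2 j js; rewrite /letter -iterSr.
rewrite split1 symbolP //.
(* A letter of weight zero has an empty piece; it is set apart because [shift] divides by the
   weight. *)
have [qb|qb] := eqVneq (q b) 0.
  rewrite qb !mul0r !addr0; split => [[h _]|/andP[h1 h2]]; first by [].
  by have := le_lt_trans h1 h2; rewrite ltxx.
have qb0 : 0 < q b by rewrite lt_def qb q_ge0.
split => [[hx hc]|hx].
  have sx : symbol x = b by apply/symbolP.
  have s01 : 0 <= shift x < 1.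
    rewrite /shift sx divr_ge0 ?subr_ge0 ?(andP hx).1 ?q_ge0 //=.
    by rewrite ltr_pdivrMr // mul1r ltrBlDl (andP hx).2.
  have /IH := s01 => /iffLR /(_ hc); rewrite /shift sx.
  by rewrite ler_pdivlMr // ltr_pdivrMr // lerBrDl ltrBlDl ![_ * q b]mulrC.
have hx' : L b <= x < L b + q b.
  case/andP: hx => h1 h2; apply/andP; split.
    by apply: le_trans h1; rewrite lerDl mulr_ge0.
  by apply: lt_le_trans h2 _; rewrite lerD2l -[leRHS]mulr1 ler_wpM2l.
split => //.
have sx : symbol x = b by apply/symbolP.
have s01 : 0 <= shift x < 1.
  rewrite /shift sx divr_ge0 ?subr_ge0 ?(andP hx').1 ?q_ge0 //=.
  by rewrite ltr_pdivrMr // mul1r ltrBlDl (andP hx').2.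
apply/(IH _ s01); rewrite /shift sx.
by rewrite ler_pdivlMr // ltr_pdivrMr // lerBrDl ltrBlDl ![_ * q b]mulrC.
Qed.

(* [letter] is only controlled on [[0, 1[]; making it constant elsewhere gives
   measurable fibers on the whole line. *)
Definition code (k : nat) (x : measurableTypeR R) : B :=
  if 0 <= x < 1 then letter k x else b0.

Lemma code_word (c : seq B) : exists a, [/\ 0 <= a, a + \prod_(b <- c) q b <= 1 &
  [set x | forall j, (j < size c)%N -> code j x = nth b0 c j] `&` `[0, 1[ =
  `[a, a + \prod_(b <- c) q b[].
Proof.
have [a [a0 a1 h]] := letter_word c; exists a; split => //.
apply/seteqP; split => x /=; rewrite !in_itv /=.
  by move=> [hx x01]; apply: (h x x01).1 => j js; have := hx j js; rewrite /code x01.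
move=> hx; have x01 : 0 <= x < 1.
  by case/andP: hx => h1 h2; rewrite (le_trans a0 h1) (lt_le_trans h2 a1).
by split => // j js; rewrite /code x01; exact: (h x x01).2.
Qed.

Lemma measurable_code k b : measurable (code k @^-1` [set b]).
Proof.
pose D : set (measurableTypeR R) := `[0, 1[.
have mD : measurable D by exact: measurable_itv.
have mW (c : seq B) : measurable ([set x | forall j, (j < size c)%N -> code j x = nth b0 c j] `&` D).
  have [a [_ _ ->]] := code_word c; exact: measurable_itv.
rewrite -[X in measurable X]setIT -(setUv D) setIUr.
have -> : code k @^-1` [set b] `&` ~` D = if b == b0 then ~` D else set0.
  apply/seteqP; split => x /=.
    rewrite /D /= in_itv /= => -[xb /negP/negbTE h]; move: xb; rewrite /code h => <-.
    by rewrite eqxx /= in_itv /= h.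
  case: eqP => // -> /=; rewrite /D /= in_itv /= /code => /negP/negbTE h; rewrite h.
  by split => //.
apply: measurableU; last by case: ifP => _ //; exact: measurableC.
have -> : code k @^-1` [set b] `&` D = \bigcup_(c in [set c : k.+1.-tuple B | nth b0 c k = b])
    ([set x | forall j, (j < size c)%N -> code j x = nth b0 c j] `&` D).
  apply/seteqP; split => x /=.
    have nt j (jk : (j < k.+1)%N) : nth b0 [tuple code i x | i < k.+1] j = code j x.
      by rewrite -[j]/(val (Ordinal jk)) -tnth_nth tnth_mktuple.
    move=> [xb Dx]; exists [tuple code j x | j < k.+1] => /=; first by rewrite nt.
    by split => // j; rewrite size_map size_enum_ord => jk; rewrite nt.
  by move=> [c /= cb [hx Dx]]; split => //; rewrite -cb; apply: hx; rewrite size_tuple.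
by apply: fin_bigcup_measurable => [|c _]; [exact: finite_finset|exact: mW].
Qed.

Lemma prob_code n (c : 'I_n -> B) :
  unit_leb [set x | forall j : 'I_n, code j x = c j] = (\prod_(j < n) q (c j))%:E.
Proof.
have [a [a0 a1 h]] := code_word [seq c j | j <- enum 'I_n].
have sz : size [seq c j | j <- enum 'I_n] = n by rewrite size_map size_enum_ord.
have -> : [set x | forall j : 'I_n, code j x = c j] =
  [set x | forall j, (j < size [seq c j | j <- enum 'I_n])%N -> code j x = nth b0 [seq c j | j <- enum 'I_n] j].
  apply/seteqP; split => x /= hx.
    move=> j; rewrite sz => jn; rewrite (hx (Ordinal jn)) (nth_map (Ordinal jn)) ?size_enum_ord //.
    by congr c; apply: val_inj; rewrite /= nth_enum_ord.
  move=> j; rewrite hx ?sz // (nth_map j) ?size_enum_ord //.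
  by congr c; apply: val_inj; rewrite /= nth_enum_ord.
rewrite /unit_leb /mrestr h lebesgue_measure_itv /= lte_fin.
rewrite big_map big_enum /= in h a1 *.
case: ifP => [_|]; first by rewrite -EFinD addrAC subrr add0r.
rewrite ltrDl => /negbT; rewrite -leNgt => w0.
by congr (_%:E); apply/eqP; rewrite eq_le w0 andbT prodr_ge0.
Qed.

End Coding.

(** * Joint laws of the letters *)

Section Model.
Variables (B : finType) (q : B -> R) (X : nat -> measurableTypeR R -> B).
Hypotheses (mX : forall k b, measurable (X k @^-1` [set b])).
Hypothesis (prob_X : forall n (c : 'I_n -> B),
  unit_leb [set x | forall j : 'I_n, X j x = c j] = (\prod_(j < n) q (c j))%:E).

Lemma prob_fibers {d} {T : measurableType d} (P : probability T R) (I : finType)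
    (K : T -> I) (Q : pred I) : (forall i, measurable (K @^-1` [set i])) ->
  P [set w | Q (K w)] = (\sum_(i | Q i) fine (P (K @^-1` [set i])))%:E.
Proof.
move=> mK; pose D := [set w | Q (K w)].
have mD : measurable D.
  rewrite (_ : D = \bigcup_(i in [set i | Q i]) K @^-1` [set i]).
    by apply: fin_bigcup_measurable => //; exact: finite_finset.
  by apply/seteqP; split => w; rewrite /D /=; [move=> h; exists (K w)|move=> [i /= Qi ->]].
have i1 := finite_measure_integrable_cst P 1 measurableT.
have [_ E] := fin_decomp (fun i => (Q i)%:R) mK i1.
rewrite -[LHS]fineK; last exact: fin_num_measure.
have <- : \int[P]_w ((Q (K w))%:R * cst 1 w) = fine (P D).
  rewrite -[RHS]mul1r -(Rintegral_cst P mD 1) [RHS]Rintegral_mkcond.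
  congr (Rintegral _ _ _); apply/funext => w; rewrite /patch /= mulr1.
  case: (boolP (Q (K w))) => h; first by rewrite mem_set.
  by rewrite memNset //; exact/negP.
rewrite E [in RHS]big_mkcond; congr (_%:E); apply: eq_bigr => i _.
rewrite (Rintegral_cst P (mK i)) mul1r; case: (Q i); by rewrite ?mul1r ?mul0r.
Qed.

Let word n x : {ffun 'I_n -> B} := [ffun j : 'I_n => X j x].

Let word_fiber n (c : {ffun 'I_n -> B}) :
  word n @^-1` [set c] = [set x | forall j : 'I_n, X j x = c j].
Proof.
apply/seteqP; split => x /=; first by move=> <- j; rewrite ffunE.
by move=> h; apply/ffunP => j; rewrite ffunE.
Qed.

(** The event is a disjoint union of word events, and a product of sums is the sum over words of the
    products. *)
Lemma prob_product n (S : 'I_n -> pred B) :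
  unit_leb [set x | forall j : 'I_n, S j (X j x)] =
  (\prod_(j < n) \sum_(b | S j b) q b)%:E.
Proof.
have mW c : measurable (word n @^-1` [set c]).
  rewrite word_fiber (_ : [set x | _] = \big[setI/setT]_(j < n) (X j @^-1` [set c j])).
    by apply: bigsetI_measurable => j _; exact: mX.
  apply/seteqP; split => x /=.
    by move=> h; elim/big_rec: _ => // j W _ Wx; split => //=; exact: h.
  by move=> + j; rewrite (bigD1 j) //= => -[].
rewrite (_ : [set x | _] = [set x | word n x \in family S]); last first.
  apply/seteqP; split => x /=.
    by move=> h; apply/familyP => j; rewrite ffunE; exact: h.
  by move=> /familyP h j; have := h j; rewrite ffunE.
rewrite (prob_fibers unit_leb (fun c : {ffun 'I_n -> B} => c \in family S) mW).
rewrite bigA_distr_big_dep; congr (_%:E); apply: eq_bigr => c _.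
by rewrite word_fiber; exact: (congr1 fine (prob_X c)).
Qed.

Lemma Rintegral_pair (f h : B -> R) i j : i != j ->
  \int[unit_leb]_x (f (X i x) * h (X j x)) = (\sum_b q b * f b) * (\sum_b q b * h b).
Proof.
move=> ij; pose K x := (X i x, X j x).
have sum_q : \sum_b q b = 1.
  have := @prob_product 1 (fun _ _ => true); rewrite big_ord1.
  by rewrite (_ : [set x | _] = setT) ?probability_setT => [[<-]//|]; apply/seteqP.
have KE b c : K @^-1` [set (b, c)] = X i @^-1` [set b] `&` X j @^-1` [set c].
  by apply/seteqP; split => x /=; rewrite /K => -[-> ->].
have mK bc : measurable (K @^-1` [set bc]).
  by case: bc => b c; rewrite KE; apply: measurableI; exact: mX.
have pK b c : fine (unit_leb (K @^-1` [set (b, c)])) = q b * q c.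
  (* Only the positions [i] and [j] are constrained; every other one contributes the total mass
     [1]. *)
  pose S (l : 'I_(i + j).+1) : pred B := fun e => ((l == i :> nat) ==> (e == b)) && ((l == j :> nat) ==> (e == c)).
  have il : (i < (i + j).+1)%N by lia.
  have jl : (j < (i + j).+1)%N by lia.
  rewrite (_ : K @^-1` _ = [set x | forall l : 'I_(i + j).+1, S l (X l x)]); last first.
    rewrite KE; apply/seteqP; split => x /=.
      by move=> [h1 h2] l; apply/andP; split; apply/implyP => /eqP ->; apply/eqP.
    move=> hx; split.
      by have := hx (Ordinal il); rewrite /S /= eqxx => /andP[/eqP].
    by have := hx (Ordinal jl); rewrite /S /= eqxx => /andP[_ /eqP].
  rewrite prob_product /= (bigD1 (Ordinal il)) //= (bigD1 (Ordinal jl)) /=; last first.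
    by rewrite -val_eqE /= eq_sym.
  rewrite [X in _ * (_ * X)]big1 ?mulr1 => [|l /andP[li lj]]; last first.
    transitivity (\sum_b q b); last exact: sum_q.
    apply: eq_bigl => e; rewrite /S.
    by rewrite -[(l : nat) == i]/(l == Ordinal il) -[(l : nat) == j]/(l == Ordinal jl) (negbTE li) (negbTE lj).
  congr (_ * _).
    by rewrite (big_pred1 b) // => e; rewrite /S /= eqxx (negbTE ij) andbT.
  by rewrite (big_pred1 c) // => e; rewrite /S /= eqxx eq_sym (negbTE ij).
have i1 := finite_measure_integrable_cst unit_leb 1 measurableT.
have [_ E] := fin_decomp (fun bc => f bc.1 * h bc.2) mK i1.
transitivity (\int[unit_leb]_x (f (K x).1 * h (K x).2 * cst 1 x)).
  by congr (Rintegral _ _ _); apply/funext => x; rewrite mulr1.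
rewrite E big_distrlr /= pair_bigA; apply: eq_bigr => -[b c] _ /=.
rewrite (Rintegral_cst unit_leb (mK (b, c))) mul1r.
have -> : fine ((unit_leb : probability _ _) (K @^-1` [set (b, c)])) = q b * q c by exact: pK.
by ring.
Qed.

End Model.

(** A single independent sequence of letters, each a delay paired with a fair sign, carries both
    processes; the product form of its weights gives their mutual independence. *)
Lemma rademacher_model (tb : nat) (p : nat -> R) :
  (forall i, (i <= tb)%N -> 0 <= p i) -> \sum_(s < tb.+1) p s = 1 ->
  exists (tau : nat -> measurableTypeR R -> 'I_tb.+1) (v : nat -> measurableTypeR R -> R),
  [/\ tau_iid unit_leb tau p, v_iid unit_leb v, finite_variance unit_leb v,
      indep_v_tau unit_leb v tau &
      (forall i, \int[unit_leb]_x v i x = 0) /\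
      (forall i j, \int[unit_leb]_x (v i x * v j x) = (i == j)%:R)].
Proof.
move=> p_ge0 sum_p.
pose B : finType := ('I_tb.+1 * bool)%type.
pose q (b : B) : R := p b.1 / 2.
have q_ge0 b : 0 <= q b by rewrite divr_ge0 // p_ge0 // -ltnS.
have sum_qF (F : 'I_tb.+1 -> bool -> R) :
    \sum_b q b * F b.1 b.2 = \sum_(t < tb.+1) p t * ((F t true + F t false) / 2).
  rewrite -(pair_bigA _ (fun t e => q (t, e) * F t e)); apply: eq_bigr => t _ /=.
  by rewrite big_bool /q /=; field.
have sum_q : \sum_b q b = 1.
  under eq_bigr do rewrite -[q _]mulr1.
  rewrite (sum_qF (fun _ _ => 1)) -[RHS]sum_p; apply: eq_bigr => t _.
  by field.
pose X := code q (ord0, true).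
have mX k b : measurable (X k @^-1` [set b]) by exact: measurable_code.
have prob_X n (c : 'I_n -> B) :
    unit_leb [set x | forall j : 'I_n, X j x = c j] = (\prod_(j < n) q (c j))%:E.
  exact: prob_code.
pose sgn (e : bool) : R := if e then 1 else -1.
pose tau k x := (X k x).1; pose v k x := sgn (X k x).2.
have prod_S n (S : 'I_n -> 'I_tb.+1 -> bool -> bool) :
    unit_leb [set x | forall j : 'I_n, S j (tau j x) (X j x).2] =
    (\prod_(j < n) \sum_(t < tb.+1) p t * (((S j t true)%:R + (S j t false)%:R) / 2))%:E.
  rewrite (prob_product mX prob_X (fun j b => S j b.1 b.2)); congr (_%:E).
  apply: eq_bigr => j _; rewrite -(sum_qF (fun t e => (S j t e)%:R)) big_mkcond.
  by apply: eq_bigr => b _; case: (S j _ _); rewrite ?mulr1 ?mulr0.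
have pick (c : 'I_tb.+1) (r : R) : \sum_(t < tb.+1) p t * ((t == c)%:R * r) = p c * r.
  rewrite (bigD1 c) //= eqxx mul1r big1 ?addr0 // => t tc.
  by rewrite (negbTE tc) mul0r mulr0.
(* The mass of [A] under the uniform law on [1] and [-1]. *)
pose pB (A : set R) : R := ((`[< A 1 >])%:R + (`[< A (-1) >])%:R) / 2.
have prob_v n (A : 'I_n -> set R) :
    unit_leb [set x | forall j : 'I_n, A j (v j x)] = (\prod_(j < n) pB (A j))%:E.
  rewrite (_ : [set x | _] = [set x | forall j : 'I_n, `[< A j (sgn (X j x).2) >]]).
    rewrite (prod_S n (fun j _ e => `[< A j (sgn e) >])); congr (_%:E).
    by apply: eq_bigr => j _; rewrite -mulr_suml sum_p mul1r.
  by apply/seteqP; split => x /= h j; apply/asboolP; exact: h.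
have prob_tau n (c : 'I_n -> 'I_tb.+1) :
    unit_leb [set x | forall j : 'I_n, tau j x = c j] = (\prod_(j < n) p (c j))%:E.
  rewrite (_ : [set x | _] = [set x | forall j : 'I_n, tau j x == c j]).
    rewrite (prod_S n (fun j t _ => t == c j)); congr (_%:E); apply: eq_bigr => j _.
    rewrite -[RHS]mulr1 -pick; apply: eq_bigr => t _; congr (_ * _).
    by rewrite mulr1; field.
  by apply/seteqP; split => x /= h j; apply/eqP; exact: h.
have m_comp (S : finType) (f : B -> S) k s : measurable ((fun x => f (X k x)) @^-1` [set s]).
  rewrite (_ : _ @^-1` _ = \bigcup_(b in [set b | f b = s]) X k @^-1` [set b]).
    by apply: fin_bigcup_measurable => //; exact: finite_finset.
  apply/seteqP; split => x /=; first by move=> h; exists (X k x).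
  by move=> [b /= <- <-].
have mv k : measurable_fun setT (v k).
  move=> _ Y mY; rewrite setTI.
  rewrite (_ : v k @^-1` Y = \bigcup_(e in [set e | Y (sgn e)]) (fun x => (X k x).2) @^-1` [set e]).
    apply: fin_bigcup_measurable => [|e _]; first exact: finite_finset.
    exact: (m_comp _ snd).
  apply/seteqP; split => x /=; first by move=> h; exists (X k x).2.
  by move=> [e /= Ye xe]; rewrite /v xe.
have Eq (f : bool -> R) : \sum_b q b * f b.2 = (f true + f false) / 2.
  by rewrite (sum_qF (fun _ e => f e)) -mulr_suml sum_p mul1r.
exists tau, v; split.
- by split => // k i; exact: (m_comp _ fst).
- split => // n A mA; transitivity ((\prod_(j < n) pB (A j))%:E); first exact: prob_v.
  congr (_%:E); apply: eq_bigr => j _.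
  have := prob_v 1 (fun _ => A j); rewrite big_ord1 => h.
  rewrite (_ : v 0%N @^-1` A j = [set x | forall j0 : 'I_1, A j (v j0 x)]); last first.
    apply/seteqP; split => x /=; first by move=> hx j0; rewrite ord1.
    by move=> /(_ ord0).
  exact: (esym (congr1 fine h)).
- rewrite /finite_variance unlock.
  rewrite (_ : (fun _ => _) = cst 1%:E); last first.
    by apply/funext => x; rewrite /v /sgn; case: (X 0 x).2; rewrite ?sqrrN expr1n.
  by rewrite integral_cst // mul1e (le_lt_trans (probability_le1 _ _)) // ltry.
- move=> n A c mA.
  transitivity ((\prod_(j < n) pB (A j))%:E * (\prod_(j < n) p (c j))%:E)%E; last first.
    by congr (_ * _)%E; [exact/esym/prob_v | exact/esym/prob_tau].
  rewrite -EFinM -big_split /=.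
  rewrite (_ : _ `&` _ = [set x | forall j : 'I_n, (tau j x == c j) && `[< A j (sgn (X j x).2) >]]).
    apply: (etrans (prod_S n (fun j t e => (t == c j) && `[< A j (sgn e) >]))); congr (_%:E).
    apply: eq_bigr => j _; rewrite mulrC -pick; apply: eq_bigr => t _; congr (_ * _).
    by rewrite /pB /sgn; case: (t == c j) => /=; rewrite ?mul1r ?mul0r // addr0 mul0r.
  apply/seteqP; split => x /=.
    by move=> [h1 h2] j; rewrite (h2 j) eqxx; apply/asboolP; exact: h1.
  by move=> h; split => j; have /andP[/eqP h1 /asboolP h2] := h j.
split => [i|i j].
  (* The mean is a pair moment with the constant [1] at another index. *)
  have := Rintegral_pair mX prob_X (fun b => sgn b.2) (fun=> 1) (_ : i != i.+1).
  rewrite Eq /= subrr !mul0r => h; rewrite -[RHS]h; last by rewrite ltn_eqF.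
  by congr (Rintegral _ _ _); apply/funext => x; rewrite mulr1.
have [->|ij] := eqVneq i j.
  rewrite (_ : (fun _ => _) = cst 1); last first.
    by apply/funext => x; rewrite /v /sgn; case: (X j x).2; rewrite ?mulrNN mulr1.
  by rewrite Rintegral_cst // mul1r; exact: (congr1 fine unit_leb_setT).
rewrite (Rintegral_pair mX prob_X (fun b => sgn b.2) (fun b => sgn b.2) ij).
by rewrite Eq /= subrr !mul0r.
Qed.

End UnitLebesgue.

(** * Boundedness of the renewal equation *)

Section Renewal.
Variables (R : realType) (f X U : nat -> R) (F : R).
Hypotheses (f_ge0 : forall k, 0 <= f k) (X_ge0 : forall k, 0 <= X k).
Hypothesis UE : forall k, U k = X k + \sum_(m < k) f (k - m)%N * U m.
Hypothesis f_cvg : (\sum_(k < N) f k) @[N --> \oo] --> F.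

Lemma renewal_ge0 k : 0 <= U k.
Proof.
elim/ltn_ind: k => k IH; rewrite UE addr_ge0 // sumr_ge0 // => m _.
by rewrite mulr_ge0 // IH.
Qed.

Lemma renewal_shift k : U k = X k + \sum_(j < k) f j.+1 * U (k - j.+1)%N.
Proof.
rewrite UE (reindex_inj rev_ord_inj) /=; congr (_ + _); apply: eq_bigr => -[j /= jk] _.
by have -> : (k - (k - j.+1) = j.+1)%N by lia.
Qed.

Lemma partial_sum_le N : \sum_(k < N) f k <= F.
Proof.
have nd : {homo (fun N => \sum_(k < N) f k) : n m / (n <= m)%N >-> n <= m}.
  move=> n m /subnKC <-; rewrite big_split_ord /= lerDl sumr_ge0 //.
have := nondecreasing_cvgn_le nd (cvgP _ f_cvg) N.
by rewrite (cvg_lim _ f_cvg).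
Qed.

Lemma partial_sum_shift_le k : \sum_(j < k) f j.+1 <= F.
Proof.
apply: le_trans (partial_sum_le k.+1).
by rewrite big_ord_recl /= lerDr.
Qed.

(** The bound is the fixed point of [x = C + F * x], hence it propagates by induction. *)
Lemma renewal_bounded C : F < 1 -> (forall k, X k <= C) -> forall k, U k <= C / (1 - F).
Proof.
move=> F1 XC; have F1' : 0 < 1 - F by rewrite subr_gt0.
have C0 : 0 <= C by apply: le_trans (X_ge0 0) (XC 0%N).
have D0 : 0 <= C / (1 - F) by rewrite divr_ge0 // ltW.
elim/ltn_ind => k IH; rewrite renewal_shift.
apply: (@le_trans _ _ (C + F * (C / (1 - F)))).
  apply: lerD; first exact: XC.
  apply: (@le_trans _ _ (\sum_(j < k) f j.+1 * (C / (1 - F)))).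
    apply: ler_sum => -[j /= jk] _; apply: ler_wpM2l => //; apply: IH; lia.
  by rewrite -mulr_suml ler_wpM2r // partial_sum_shift_le.
rewrite le_eqVlt; apply/orP; left; apply/eqP; field.
by rewrite gt_eqF.
Qed.

Hypothesis X_nd : forall k, X k <= X k.+1.

Lemma renewal_nd k : U k <= U k.+1.
Proof.
elim/ltn_ind: k => k IH; rewrite !renewal_shift big_ord_recr /= addrA -[leLHS]addr0.
apply: lerD; last by rewrite mulr_ge0 // renewal_ge0.
apply: lerD => //; apply: ler_sum => -[j /= jk] _; apply: ler_wpM2l => //.
have -> : (k.+1 - j.+1 = (k - j.+1).+1)%N by lia.
apply: IH; lia.
Qed.

Lemma renewal_leq k l : (k <= l)%N -> U k <= U l.
Proof. exact: (homo_leq (fun x => lexx x) (fun y x z => @le_trans _ _ y x z) renewal_nd). Qed.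

Lemma input_leq k l : (k <= l)%N -> X k <= X l.
Proof. exact: (homo_leq (fun x => lexx x) (fun y x z => @le_trans _ _ y x z) X_nd). Qed.

(* If [U] had a finite supremum [L], letting [J] tend to infinity in
   [U (k + J) >= X k + (f 1 + .. + f J) U k] would give [L >= X k + F L]. *)
Lemma renewal_unbounded k0 : f 0%N = 0 -> 1 <= F -> 0 < X k0 -> forall M, exists k, M < U k.
Proof.
move=> f0 F1 Xk0 M; apply: contrapT => /forallNP hM.
have UM k : U k <= M by rewrite leNgt; apply/negP; exact: hM.
pose A := range U; have Aub : ubound A M by move=> _ [k _ <-].
have UL k : U k <= sup A by apply: ub_le_sup; [exists M|exists k].
have step k : (k0 <= k)%N -> U k <= sup A - X k0.
  move=> k0k.
  have cv : ((\sum_(j < N) f j) * U k) @[N --> \oo] --> F * U k.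
    by apply: cvgM => //; exact: cvg_cst.
  have FU : U k <= F * U k by rewrite -[leLHS]mul1r ler_wpM2r ?renewal_ge0.
  apply: le_trans FU _; rewrite -(cvg_lim _ cv) //.
  apply: limr_le; first exact: (cvgP _ cv).
  apply: nearW => N; rewrite lerBrDl; apply: le_trans (UL (k + N)%N).
  rewrite [leRHS]renewal_shift; apply: lerD; first by apply: input_leq; lia.
  apply: (@le_trans _ _ (\sum_(j < N) f j.+1 * U k)).
    rewrite -mulr_suml ler_wpM2r ?renewal_ge0 //.
    case: N => [|N]; first by rewrite !big_ord0.
    by rewrite big_ord_recl f0 add0r big_ord_recr /= lerDl.
  rewrite addnC big_split_ord /= -[leLHS]addr0. apply: lerD.
    apply: ler_sum => -[j /= jN] _; apply: ler_wpM2l => //; apply: renewal_leq; lia.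
  by apply: sumr_ge0 => j _; rewrite mulr_ge0 ?renewal_ge0.
have : sup A <= sup A - X k0.
  apply: ge_sup; first by exists (U 0%N); exists 0%N.
  move=> _ [k _ <-]; have [k0k|/ltnW kk0] := leqP k0 k; first exact: step.
  exact: le_trans (renewal_leq kk0) (step _ (leqnn _)).
by rewrite lerBrDr -lerBrDl subrr leNgt Xk0.
Qed.

End Renewal.

(** * The two implications *)

Section Stability.
Variables (R : realType) (tb : nat) (alpha p : nat -> R).
Variables (bP aP bK aK phi : {poly R}).
Hypothesis p01 : forall i, (i <= tb)%N -> 0 <= p i <= 1.
Hypothesis sum_p : \sum_(i < tb.+1) p i = 1.
Hypotheses (aP0 : aP`_0 != 0) (bP0 : bP`_0 = 0) (aK0 : aK`_0 != 0).
Hypothesis stab : internally_stable tb alpha p bP aP bK aK.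
Hypothesis spec : spectral_factor tb alpha p phi.

Let chi := char_loop tb alpha p bP aP bK aK.

Let p_ge0 i : (i <= tb)%N -> 0 <= p i.
Proof. by move=> /p01/andP[]. Qed.

(* [g] is the impulse response of [KP / (1 - HKP)], from the plant input to [u]. *)
Lemma closed_loop_response : exists (d n : {poly R}) (g : nat -> R),
  [/\ disc_free d, d`_0 != 0, d * (bK * bP) = chi * n & convol (coefs d) g = coefs n].
Proof.
(* This component of internal stability concerns [KP / (1 - HKP)]; its reduced denominator is the
   [d] below. *)
have [_ _ _ _ [[chi_neq0 hroot] _ _]] := stab.
pose c := gcdp (bK * bP) chi.
pose d := chi %/ c; pose n := (bK * bP) %/ c.
have chiE : chi = d * c by rewrite /d divpK // dvdp_gcdr.
have nE : bK * bP = n * c by rewrite /n divpK // dvdp_gcdl.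
have cd : disc_free d.
  split => //; apply: contra_neq chi_neq0 => d0.
  by rewrite -/chi chiE d0 mul0r.
have d0 : d`_0 != 0.
  have := cd.2 0; rewrite sqmodE ComplexField.Normc.normc0 expr0n ler01 => /(_ isT).
  rewrite /root horner_coef0 coef_map; by apply: contra => /eqP ->.
have [b bE] := @convol_inv _ (coefs d) d0.
exists d, n, (convol b (coefs n)); split => //.
  by rewrite chiE nE; ring.
by rewrite convolA bE convol1.
Qed.

Lemma stable_of_H2_lt1 : (H2_sq tb alpha p bP aP bK aK phi < 1)%E ->
  ms_io_stable tb alpha p bP aP bK aK.
Proof.
move=> H2; split => // d0 T P tau v tauI vI v2 vtau y u ud loop.
have [d [n [g [cd d00 dn dg]]]] := closed_loop_response.
have aPn : aP != 0 by apply: contra_neq aP0 => ->; rewrite coef0.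
have aKn : aK != 0 by apply: contra_neq aK0 => ->; rewrite coef0.
have chin : chi != 0 by have [_ _ _ _ [[]]] := stab.
have [F [FE Fcvg]] := H2_sq_cvg sum_p aPn aKn chin spec cd dn dg.
have [B hB] := disc_free_abs_summable cd dg.
have uE k w : u k w = convol g (fun m => v m w) k +
    \sum_(m < k) gain tb alpha p g (k - m) (tau m w) * u m w.
  exact: (loop_eqs_rec aP0 aK0 bP0 d00 dn dg (loop w)).
have mom := second_moment p_ge0 sum_p tauI vI v2 vtau uE.
have bnd := second_moment_x_bound vI v2 hB.
have F1 : F < 1 by rewrite -lte_fin -FE.
have f0 k : 0 <= fvar tb alpha p g k.
  by apply: sumr_ge0 => s _; rewrite mulr_ge0 ?sqr_ge0 // p_ge0 // -ltnS.
have X0 k : 0 <= \int[P]_w (convol g (fun m => v m w) k * convol g (fun m => v m w) k).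
  by apply: Rintegral_ge0 => w _; rewrite -expr2 sqr_ge0.
have := renewal_bounded f0 X0 mom Fcvg F1 bnd.
set M := _ / _ => hM; exists M => k.
have hu := lin_u uE.
rewrite (variance_lin p_ge0 sum_p tauI vI v2 vtau (hu k)) lee_fin.
by apply: le_trans (hM k); rewrite lerBlDr lerDl sqr_ge0.
Qed.

Lemma H2_lt1_of_stable : ms_io_stable tb alpha p bP aP bK aK ->
  (H2_sq tb alpha p bP aP bK aK phi < 1)%E.
Proof.
move=> [_ st].
have [d [n [g [cd d00 dn dg]]]] := closed_loop_response.
have aPn : aP != 0 by apply: contra_neq aP0 => ->; rewrite coef0.
have aKn : aK != 0 by apply: contra_neq aK0 => ->; rewrite coef0.
have chin : chi != 0 by have [_ _ _ _ [[]]] := stab.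
have [F [FE Fcvg]] := H2_sq_cvg sum_p aPn aKn chin spec cd dn dg.
rewrite FE lte_fin ltNge; apply/negP => F1.
have [tau [v [tauI vI v2 vtau [v1 v12]]]] := rademacher_model p_ge0 sum_p.
(* The loop is solved separately for each outcome; integrability of the resulting [u] comes from
   [lin_u]. *)
have [yuud loop] := choice (fun w => loop_eqs_exists alpha bK aP0 aK0 bP0 (fun k => v k w) (fun k => tau k w)).
pose u k w := (yuud w).1.2 k.
have [M hM] := st _ _ _ tau v tauI vI v2 vtau (fun k w => (yuud w).1.1 k) u
  (fun k w => (yuud w).2 k) loop.
have uE k w : u k w = convol g (fun m => v m w) k +
    \sum_(m < k) gain tb alpha p g (k - m) (tau m w) * u m w.
  exact: (loop_eqs_rec aP0 aK0 bP0 d00 dn dg (loop w)).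
have mom := second_moment p_ge0 sum_p tauI vI v2 vtau uE.
have mean := first_moment p_ge0 sum_p tauI vI v2 vtau uE.
have gz := g0 aP0 aK0 bP0 d00 dn dg.
(* Uncorrelated inputs of unit variance leave only the diagonal of [second_moment_x], the partial
   energy of [g]. *)
pose X k := \sum_(i < k.+1) g i ^+ 2.
have XE k : \int[@unit_leb R]_w (convol g (fun m => v m w) k * convol g (fun m => v m w) k) = X k.
  rewrite (second_moment_x vI v2); apply: eq_bigr => i _.
  rewrite (bigD1 i) //= v12 eqxx mulr1 big1 ?addr0 // => j ji.
  rewrite v12 (_ : _ == _ = false) ?mulr0 //.
  apply: contraNF ji => /eqP h; apply/eqP/val_inj => /=.
  by have := ltn_ord i; have := ltn_ord j; lia.
have f_ge0 k : 0 <= fvar tb alpha p g k.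
  by apply: sumr_ge0 => s _; rewrite mulr_ge0 ?sqr_ge0 // p_ge0 // -ltnS.
have X_ge0 k : 0 <= X k by apply: sumr_ge0 => i _; exact: sqr_ge0.
have X_nd k : X k <= X k.+1 by rewrite /X [leRHS]big_ord_recr /= lerDl sqr_ge0.
have f0 : fvar tb alpha p g 0 = 0.
  by rewrite /fvar big1 // => s _; rewrite /convol big_ord1 /= gz mulr0 expr0n mulr0.
(* If the energy never became positive, [g] and hence [F] would vanish, against [1 <= F]. *)
have [k0 Xk0] : exists k0, 0 < X k0.
  apply: contrapT => /forallNP h.
  have gk k : g k = 0.
    have : X k <= 0 by rewrite leNgt; apply/negP; exact: h.
    rewrite /X big_ord_recr /= => Xk; apply/eqP; rewrite -sqrf_eq0 eq_le sqr_ge0 andbT.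
    by apply: le_trans Xk; rewrite lerDr sumr_ge0 // => i _; exact: sqr_ge0.
  have : F = 0.
    rewrite -(cvg_lim _ Fcvg) // (_ : (fun N => _) = cst 0) ?lim_cst //.
    apply/funext => N; rewrite big1 // => k _; rewrite /fvar big1 // => s _.
    by rewrite /convol big1 ?expr0n ?mulr0 // => i _; rewrite gk mulr0.
  by move=> F0; move: F1; rewrite F0 ler10.
have mom' k : \int[@unit_leb R]_w (u k w * u k w) =
    X k + \sum_(m < k) fvar tb alpha p g (k - m) * \int[@unit_leb R]_w (u m w * u m w).
  by rewrite -XE; exact: mom.
have [k] := renewal_unbounded f_ge0 X_ge0 mom' Fcvg X_nd f0 F1 Xk0 M.
apply/negP; rewrite -leNgt.
have := hM k; rewrite (variance_lin p_ge0 sum_p tauI vI v2 vtau (lin_u uE k)) lee_fin.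
have -> : \int[@unit_leb R]_w u k w = 0.
  apply: (etrans (mean k)).
  transitivity (\int[@unit_leb R]_w (\sum_(i < k.+1) g i * v (k - i)%N w)); first by [].
  have iv i : (@unit_leb R).-integrable setT (EFin \o v i).
    exact: integrable_v1.
  rewrite Rintegral_bigsum //; last by move=> i; exact: integrable_EFinZl.
  by rewrite big1 // => i _; rewrite RintegralZl // v1 mulr0.
by rewrite expr0n subr0.
Qed.

End Stability.

Local Close Scope classical_set_scope.
Unset Implicit Arguments.

Theorem theorem3p1 (R : realType) (tb : nat) (alpha p : nat -> R)
    (bP aP bK aK phi : {poly R}) :
  (1 <= tb)%N ->
  (* A1: p is a probability distribution on {0, ..., tb} *)
  (forall i, (i <= tb)%N -> 0 <= p i <= 1) ->
  \sum_(i < tb.+1) p i = 1 ->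
  (* P = bP(z^-1)/aP(z^-1): strictly proper real-rational, coprime repr. *)
  aP`_0 != 0 -> bP`_0 = 0 -> coprimep bP aP ->
  (* A3: no unstable pole-zero cancellation between H and P *)
  no_unstable_cancel tb alpha p aP ->
  (* K = bK(z^-1)/aK(z^-1): proper real-rational, and K in the class K *)
  aK`_0 != 0 ->
  internally_stable tb alpha p bP aP bK aK ->
  (* Phi: minimum-phase spectral factor of S_Omega *)
  spectral_factor tb alpha p phi ->
  ms_io_stable tb alpha p bP aP bK aK <->
  (H2_sq tb alpha p bP aP bK aK phi < 1)%E.
Proof.
move=> _ p01 sum_p aP0 bP0 _ _ aK0 stab spec.
by split; [exact: H2_lt1_of_stable | exact: stable_of_H2_lt1].
Qed.
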